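(* Let $2\le k\le 7$ and let $n\geq 1$ be an integer. Then $f_n(k)$ is the minimum of the values $v$ listed below for $k$ whose attached condition on $n$ is satisfied (and $f_n(k)=\infty$ if no condition listed for $k$ is satisfied): - $k=2$: $v=3$ if $n\ge 4$. - $k=3$: $v=5$ if $n\ge 6$ and $2\mid n$; $v=6$ if $n\ge 7$. - $k=4$: $v=8$ if $9\mid n$; $v=9$ if $n\ge 10$ and $2\mid n$; $v=9$ if $n\ge 12$ and $3\mid n$; $v=10$ if $n\ge 11$. - $k=5$: $v=13$ if $n\ge 14$ and $2\mid n$; $v=14$ if $15\mid n$; $v=15$ if $n\ge 16$. - $k=6$: $v=19$ if $n\ge 20$ and $2\mid n$; $v=20$ if $21\mid n$; $v=21$ if $n\ge 22$. - $k=7$: $v=24$ if $25\mid n$; $v=25$ if $n\ge 26$ and $2\mid n$; $v=26$ if $27\mid n$; $v=27$ if $n\ge 30$ and $3\mid n$; $v=27$ if $n\ge 30$ and $5\mid n$; $v=28$ if $n\ge 29$.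
   Context: For a positive integer $n$ write $\mathbb{Z}_n=\mathbb{Z}/n\mathbb{Z}$. For a subset $B$ of $\mathbb{Z}_n$ let $\Sigma(B)=\{\sum_{b\in C} b \mid C\subset B\}$ be the set of all subset sums of $B$ (the empty subset $C=\emptyset$ is included and contributes $0$). The set $B$ is called zero-sum free if no non-empty subset of $B$ has sum $0$. For positive integers $n,k$ define $f_n(k)=\min_B\left(|\Sigma(B)|-1\right)$, where $B$ runs over all zero-sum free subsets of $\mathbb{Z}_n$ with exactly $k$ (distinct) elements; if there is no such $B$, set $f_n(k)=\infty$. *)

(* Defs.v *)
From mathcomp Require Import all_boot all_order all_algebra.

Set Implicit Arguments.
Unset Strict Implicit.
Unset Printing Implicit Defensive.

(* Z/nZ for n >= 1, the trivial group 'I_1 when n = 1; 'Z_n would give Z/2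
   there. Its additive structure is the library's arithmetic modulo n.
   At n = 0 this is a junk value. *)
Notation Zmod n := 'I_(n.-1.+1).

Section SubsetSums.
Variable n : nat.
Implicit Types B C : {set Zmod n}.

Definition subset_sum C : Zmod n := (\sum_(b in C) b)%R.

Definition Sigma B : {set Zmod n} :=
  [set subset_sum C | C : {set Zmod n} in powerset B].

Definition zero_sum_free B : bool :=
  [forall (C : {set Zmod n} | (C \subset B) && (C != set0)),
     subset_sum C != 0%R].

End SubsetSums.

(* Minimum on nat extended with infinity, which is represented by None: the
   neutral element of this operation, hence the minimum of an empty family. *)
Definition min_infty : option nat -> option nat -> option nat :=
  oAC minnA minnC.

Definition f (n k : nat) : option nat :=
  \big[min_infty/None]_(B : {set Zmod n} | zero_sum_free B && (#|B| == k))
    Some (#|Sigma B| - 1).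

(* Pairs (v, condition on n attached to v). *)
Definition listed (k n : nat) : seq (nat * bool) :=
  match k with
  | 2 => [:: (3, 4 <= n)]
  | 3 => [:: (5, (6 <= n) && (2 %| n)); (6, 7 <= n)]
  | 4 => [:: (8, 9 %| n); (9, (10 <= n) && (2 %| n));
             (9, (12 <= n) && (3 %| n)); (10, 11 <= n)]
  | 5 => [:: (13, (14 <= n) && (2 %| n)); (14, 15 %| n); (15, 16 <= n)]
  | 6 => [:: (19, (20 <= n) && (2 %| n)); (20, 21 %| n); (21, 22 <= n)]
  | 7 => [:: (24, 25 %| n); (25, (26 <= n) && (2 %| n)); (26, 27 %| n);
             (27, (30 <= n) && (3 %| n)); (27, (30 <= n) && (5 %| n));
             (28, 29 <= n)]
  | _ => [::]
  end.

(* Main.v *)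
From HB Require Import structures.
From Stdlib Require Import ZArith.
Require Import Defs.
From mathcomp Require Import all_boot all_algebra all_fingroup cyclic.
From mathcomp Require Import zify ssrZ.

Set Implicit Arguments.
Unset Strict Implicit.
Unset Printing Implicit Defensive.

Import GRing.Theory.

(** Two facts have to be matched: every listed value whose condition holds is
reached by some zero-sum free set ([upper_bound]), and every zero-sum free set
has at least as many non-zero sums as some such value ([lower_bound]).

The extremal sets are explicit. In a group with a subgroup of order p, take
points i + c.(n/p) with small i; as long as the i-coordinates cannot wrap
around, their sums are counted in Z x Z/p, independently of n ([realize]).
The condition on n says that p divides n and that there is room.

For the lower bound, B may be assumed to generate Z/m for some m dividing n,
because the conditions pass from m to n ([cyclic_core], [attained_dvdn]). If m
is small, all sets are enumerated, up to multiplication by units of Z/m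
([brute_force]). If m is large, let S be the set of sums of B and suppose that
|S| is smaller than claimed.

The first step is Olson's. Removing x from B leaves at most |S & (S + x)| sums.
If this were large for every x in B, then S would overlap heavily with all its
translates by elements close to 0 in the Cayley graph of B and -B. The balls of
this graph grow at a known linear rate ([isoperimetry], [card_ball]), whereas
the overlaps over the whole group add up to |S|^2 ([averaging]). Hence some x
can be removed so that the sums of the remaining set are also few
([exists_small_deletion]). Iterating, B is built from a set of 4 elements
(3 when |B| = 3) by adding one element at a time, with a known bound on the
number of sums at each stage.

The second step is a finite search. Two of the 2^4 formal sums of the first
four elements agree, so these are integer combinations of three letters. The
bounds then keep forcing coincidences between formal sums. Each coincidence is
an additive relation between the letters, valid whatever the group is; and each
new element is a difference of two known sums. The search follows all
possibilities and closes a branch when a non-empty subset has sum 0, when sums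
counted as distinct collapse, when more distinct sums appear than the bound
allows, or when the relations bound the order of the group generated by the
letters by less than m ([search_sound]). The arithmetic
of m enters through one rule: if p is prime to m, then a relation p v = 0 gives
v = 0. The cases of the theorem differ by the primes for which this rule is
available. *)

(** * The isoperimetric inequality for a symmetric generating set *)

(** Comparing d N + a with e N + b compares (d, a) with (e, b)
lexicographically, when the second coordinates are less than N. *)
Lemma lex_leq N d e a b :
  d * N + a <= e * N + b -> b < N -> d <= e /\ (e <= d -> a <= b).
Proof.
move=> le ltb; have le_de : d <= e.
  rewrite leqNgt; apply/negP=> lt; have := leq_mul lt (leqnn N).
  by rewrite mulSn; lia.
by split=> // le_ed; have E : d = e by [lia]; rewrite E in le; lia.
Qed.

Section Isoperimetry.
Local Open Scope group_scope.
Variable gT : finGroupType.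
Implicit Types (A C X S : {set gT}) (x y z : gT).

(** A name without the canonical group structures of the product of sets. *)
Definition mulset A X : {set gT} := A * X.

(** Hamidoune's method: among the sets C with C X different from the whole
group, minimize |C X| - |C|, then |C|. Intersections of two translates of a
minimizer are either empty or everything, by submodularity of |C X|, so that
one translate is a subgroup H. Since X generates, H X contains a second
coset of H, whence |H X| - |H| >= |H X| / 2 >= |X| / 2. *)
Theorem isoperimetry X A :
    1 \in X -> X^-1 = X -> <<X>> = setT -> A != set0 -> mulset A X != setT ->
  (2 * #|A| + #|X| <= 2 * #|mulset A X|)%N.
Proof.
move=> X1 Xi Xg A0 AX.
have sub_mul C : C \subset mulset C X.
  by apply/subsetP=> y yC; rewrite -[y]mulg1 mem_mulg.
have card_le C : (#|C| <= #|mulset C X|)%N by apply: subset_leq_card.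
pose admissible C := (C != set0) && (mulset C X != setT).
pose cost C := ((#|mulset C X| - #|C|) * #|gT|.+1 + #|C|)%N.
have PA : admissible A by rewrite /admissible A0.
case: (arg_minnP cost PA) => {}A0' /andP[M0 MX] Mmin.
move: A0' M0 MX Mmin => M M0 MX Mmin.
have defmin C : admissible C -> (#|mulset M X| + #|C| <= #|mulset C X| + #|M|)%N.
  move=> /Mmin/lex_leq; rewrite ltnS max_card => /(_ isT)[].
  by have := card_le C; have := card_le M; lia.
have sizemin C : admissible C -> (#|mulset C X| + #|M| <= #|mulset M X| + #|C|)%N ->
    (#|M| <= #|C|)%N.
  move=> /Mmin/lex_leq; rewrite ltnS max_card => /(_ isT)[_].
  by have := card_le C; have := card_le M; lia.
(* The complement C of M X satisfies C X <= ~ M since X is symmetric, so it is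
   as good as M for the first criterion. *)
have halfM : (#|M| + #|mulset M X| <= #|gT|)%N.
  pose C := ~: mulset M X.
  have CX : mulset C X \subset ~: M.
    apply/subsetP=> y /mulsgP[c x /[!inE] cC xX ->].
    apply: contra cC => cxM; rewrite -[c](mulgK x); apply: mem_mulg => //.
    by rewrite -Xi inE invgK.
  have aC : admissible C.
    apply/andP; split; first by apply: contraNneq MX => C0; rewrite -[mulset M X]setCK -/C C0 setC0.
    apply: contraNneq M0 => CT; rewrite CT in CX.
    by rewrite -subset0 -setCS setC0.
  have cC : (#|C| + #|mulset M X| = #|gT|)%N by rewrite addnC /C cardsC.
  have cM : (#|M| + #|~: M| = #|gT|)%N := cardsC M.
  have lCX := subset_leq_card CX.
  suff : (#|M| <= #|C|)%N by lia.
  by apply: sizemin aC _; lia.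
have lmulX g C : mulset (g *: C) X = g *: mulset C X by rewrite /mulset -mulgA.
case/set0Pn: (M0) => a aM.
pose H : {set gT} := a^-1 *: M.
have cHX : #|mulset H X| = #|mulset M X| by rewrite lmulX card_lcoset.
have cH : #|H| = #|M| by rewrite card_lcoset.
have H1 : 1 \in H by rewrite mem_lcoset invgK mulg1.
have HX : mulset H X != setT.
  by apply: contraNneq MX => HT; rewrite eqEcard subsetT cardsT -cHX HT cardsT /=.
(* If H and b^-1 H met in a smaller set I, then I would have a larger boundary
   than H. By submodularity the union has a smaller one, which is impossible
   unless its product with X is everything; halfM excludes that. *)
have transl b : b \in H -> b^-1 *: H = H.
  move=> bH; apply/eqP; rewrite eq_sym eqEcard card_lcoset leqnn andbT.
  pose D : {set gT} := b^-1 *: H; pose I : {set gT} := H :&: D.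
  rewrite -/D; apply/setIidPl/eqP; rewrite -/I.
  have I1 : 1 \in I by rewrite inE H1 mem_lcoset invgK mulg1.
  rewrite eqEcard subsetIl /= leqNgt; apply/negP=> ltI.
  have aI : admissible I.
    apply/andP; split; first by apply/set0Pn; exists 1.
    apply: contraNneq HX => IT; rewrite -subTset -IT.
    by apply: mulSg; apply: subsetIl.
  have IX : mulset I X \subset mulset H X :&: mulset D X.
    by rewrite subsetI !mulSg ?subsetIl ?subsetIr.
  have cDX : #|mulset D X| = #|mulset M X| by rewrite lmulX card_lcoset.
  have cD : #|D| = #|M| by rewrite card_lcoset.
  have UX : mulset (H :|: D) X = mulset H X :|: mulset D X.
    apply/setP=> y; rewrite inE; apply/mulsgP/orP.
      by case=> h x /setUP[] hH xX ->; [left|right]; apply: mem_mulg.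
    by case=> /mulsgP[h x hH xX ->]; exists h x => //; rewrite inE hH ?orbT.
  have e1 : (#|mulset H X :|: mulset D X| + #|mulset H X :&: mulset D X|
      = #|mulset M X| + #|mulset M X|)%N by rewrite cardsUI cHX cDX.
  have e2 : (#|H :|: D| + #|I| = #|M| + #|M|)%N by rewrite cardsUI cH cD.
  have leI := subset_leq_card IX; have I0 : (0 < #|I|)%N by apply/card_gt0P; exists 1.
  have ltM : (#|I| < #|M|)%N by rewrite -cH.
  have defI : (#|mulset M X| + #|I| < #|mulset I X| + #|M|)%N.
    by rewrite ltnNge; apply/negP=> /(sizemin I aI); rewrite leqNgt ltM.
  have aU : admissible (H :|: D) || (#|mulset H X :|: mulset D X| == #|gT|).
    have [UT|UT] := eqVneq (mulset (H :|: D) X) setT.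
      by rewrite -UX UT cardsT eqxx orbT.
    apply/orP; left; rewrite /admissible UT andbT.
    by apply/set0Pn; exists 1; rewrite inE H1.
  case/orP: aU => [/defmin defU|/eqP UX'].
    rewrite UX in defU.
    by clear -e1 e2 leI defI defU; lia.
  by clear -e1 e2 leI defI halfM I0 UX'; lia.
have Hgrp : group_set H.
  apply/group_setP; split=> // x y xH yH.
  have : y \in x^-1 *: H by rewrite transl.
  by rewrite mem_lcoset invgK.
pose K := Group Hgrp.
have [x xX xH] : exists2 x, x \in X & x \notin H.
  apply/subsetPn; apply: contra HX => XH.
  have HT : H = setT by apply/eqP; rewrite -subTset -Xg (gen_subG _ K).
  by rewrite eqEsubset subsetT -{1}HT sub_mul.
have xHX : H :* x \subset mulset H X by rewrite mulgS ?sub1set.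
have HHX := sub_mul H.
have XHX : X \subset mulset H X.
  by apply/subsetP=> y yX; rewrite -[y]mul1g mem_mulg.
have dis : H :&: H :* x = set0.
  apply/eqP; rewrite -subset0; apply/subsetP=> y; rewrite inE mem_rcoset => /andP[yH].
  move=> /(groupM (groupVr (yH : y \in K))); rewrite mulKg => /groupVr.
  by rewrite invgK (negPf xH).
have := cardsUI H (H :* x); rewrite dis cards0 card_rcoset.
have : (#|H :|: H :* x| <= #|mulset H X|)%N by apply: subset_leq_card; rewrite subUset HHX.
have := subset_leq_card XHX; have aA : admissible A by rewrite /admissible A0.
have := defmin A aA; rewrite cHX cH; clear; lia.
Qed.
End Isoperimetry.

(** * Overlaps of a set with its translates *)

(** A lower bound on the ball of radius i when |X| >= xs and the group has at
least n0 elements: each further multiplication by X adds |X| / 2 elements. *)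
Definition ball_size xs n0 i : nat :=
  if i is i'.+1 then minn n0 (xs + i' * uphalf xs) else 1.

(** With mu = s - (T + 1), a set S of s elements that overlaps its translates
by X in more than T elements overlaps those by the ball of radius i in at least
s - i mu elements. Summed over shells this is mu times the sizes of the balls
of radius i < c, for c = s / mu, plus the remainder s - c mu times the ball of
radius c. The test says that this exceeds the total s^2 of all overlaps. *)
Definition averaging_fails s T xs n0 :=
  let mu := s - T.+1 in let c := s %/ mu in
  s * s < mu * sumn [seq ball_size xs n0 i | i <- iota 0 c]
    + (s - mu * c) * ball_size xs n0 c.

Lemma sum_leq_ord c d : \sum_(i < c) (d <= i) = c - d.
Proof. by elim: c => [|c IH]; rewrite ?big_ord0 // big_ord_recr /= IH; lia. Qed.

Section Averaging.
Local Open Scope group_scope.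
Variable gT : finGroupType.
Implicit Types (A C X S : {set gT}) (x y z : gT).

Definition translate S z : {set gT} := S :* z.
Definition rep S z := #|S :&: translate S z|.

Lemma mem_translate S y z : (y \in translate S z) = (y * z^-1 \in S).
Proof. exact: mem_rcoset. Qed.

Lemma card_translate S z : #|translate S z| = #|S|.
Proof. exact: card_rcoset. Qed.

Lemma rep1 S : rep S 1 = #|S|.
Proof. by rewrite /rep /translate mulg1 setIid. Qed.

Lemma repV S z : rep S z^-1 = rep S z.
Proof.
rewrite /rep -(card_translate (S :&: translate S z^-1) z) setIC.
congr #|pred_of_set _|; apply/setP=> y.
by rewrite mem_translate !inE !mem_translate invgK mulgKV.
Qed.

(** S & S z and (S & S y) z both lie in S z, and they meet inside S y z. *)
Lemma repM S y z : (rep S y + rep S z <= rep S (y * z)%g + #|S|)%N.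
Proof.
pose A := S :&: translate S z; pose C := translate (S :&: translate S y) z.
have cC : #|C| = rep S y by rewrite card_translate.
have sub : A :&: C \subset S :&: translate S (y * z).
  apply/subsetP=> w; rewrite !inE !mem_translate !inE !mem_translate invMg !mulgA.
  by case/andP=> /andP[-> _] /andP[_ ->].
have subU : A :|: C \subset translate S z.
  apply/subsetP=> w; rewrite !inE !mem_translate !inE.
  by case/orP=> /andP[].
have := subset_leq_card sub; have := subset_leq_card subU.
rewrite card_translate => le1 le2; have := cardsUI A C; rewrite cC.
rewrite -/(rep S (y * z)) in le2; rewrite -/(rep S z) => e; clear -e le1 le2; lia.
Qed.

(** Each pair of elements of S is counted for exactly one translation. *)
Lemma sum_rep S : (\sum_z rep S z = #|S| * #|S|)%N.
Proof.
have -> : (\sum_z rep S z = \sum_z \sum_(y in S) ((y * z^-1)%g \in S))%N.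
  apply: eq_bigr => z _; rewrite /rep -sum1_card big_mkcond [RHS]big_mkcond /=.
  by apply: eq_bigr => y _; rewrite inE mem_translate; case: (y \in S); case: (_ \in S).
rewrite exchange_big /= -sum_nat_const; apply: eq_bigr => y yS.
rewrite (reindex_inj (mulIg y)) /= (reindex_inj invg_inj) /= -[RHS]sum1_card [RHS]big_mkcond /=.
by apply: eq_bigr => z _; rewrite invMg invgK mulKVg; case: (z \in S).
Qed.

Fixpoint ball X i : {set gT} := if i is i'.+1 then mulset (ball X i') X else [set 1].

Lemma ball_sub X i j : 1 \in X -> i <= j -> ball X i \subset ball X j.
Proof.
move=> X1 /subnK <-; elim: (j - i)%N => // d; rewrite addSn /= => /subset_trans; apply.
by apply/subsetP=> y yB; rewrite -[y]mulg1 mem_mulg.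
Qed.

Lemma rep_ball S X m i z : {in X, forall x, #|S| <= rep S x + m} ->
  z \in ball X i -> #|S| <= rep S z + i * m.
Proof.
move=> HX; elim: i z => [|i IH] z /=.
  by move=> /set1P ->; rewrite rep1 leq_addr.
case/mulsgP=> y x /IH Hy /HX Hx ->.
have R r : (rep S y + rep S x <= r + #|S| -> #|S| <= r + i.+1 * m)%N.
  by rewrite mulSn; clear -Hx Hy; lia.
by apply: R; apply: repM.
Qed.

(** [isoperimetry] at each radius: a ball gains at least |X| / 2 elements
unless it becomes the whole group. *)
Lemma card_ball X xs n0 i : 1 \in X -> X^-1 = X -> <<X>> = setT ->
  xs <= #|X| -> n0 <= #|gT| -> ball_size xs n0 i <= #|ball X i|.
Proof.
move=> X1 Xi Xg lex len; case: i => [|i] /=; first by rewrite cards1.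
elim: i => [|i IH].
  rewrite /= mul0n addn0 (leq_trans (geq_minr _ _)) // (leq_trans lex) //.
  by apply: subset_leq_card; apply/subsetP=> y yX; rewrite -[y]mul1g mem_mulg ?set11.
pose A := ball X i.+1; have {}IH : (minn n0 (xs + i * uphalf xs) <= #|A|)%N := IH.
change (minn n0 (xs + i.+1 * uphalf xs) <= #|mulset A X|)%N.
have sA : A \subset mulset A X.
  by apply/subsetP=> y yA; rewrite -[y]mulg1 mem_mulg.
have [->|nT] := eqVneq (mulset A X) setT; first by rewrite cardsT (leq_trans (geq_minl _ _)).
have A0 : A != set0.
  by apply/set0Pn; exists 1; apply: (subsetP (@ball_sub X 0 i.+1 X1 isT)); rewrite set11.
have iso := isoperimetry X1 Xi Xg A0 nT; have cA := subset_leq_card sA.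
have uh : (uphalf xs + uphalf xs <= xs.+1)%N by have := odd_double_half xs; rewrite uphalf_half; clear; case: odd => /=; lia.
rewrite mulSn; clear -iso IH lex cA uh.
by lia.
Qed.

(** The overlaps sum to |S|^2 over the whole group, while on the ball of radius
i each of them is at least |S| - i mu by subadditivity ([rep_ball]). *)
Lemma averaging S X s T xs n0 : 1 \in X -> X^-1 = X -> <<X>> = setT ->
  xs <= #|X| -> n0 <= #|gT| -> #|S| = s -> T.+1 < s ->
  {in X, forall x, T < rep S x} -> ~~ averaging_fails s T xs n0.
Proof.
move=> X1 Xi Xg lex len cS ltT HX; rewrite /averaging_fails -leqNgt sumnE big_map.
rewrite -[X in iota 0 X]subn0 -/(index_iota 0 _) big_mkord.
set mu := (s - T.+1)%N; set c := (s %/ mu)%N.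
have mu0 : (0 < mu)%N by rewrite subn_gt0.
have lec : (c * mu <= s)%N := leq_divM s mu.
have HX' : {in X, forall x, #|S| <= rep S x + mu}.
  by move=> x /HX; rewrite cS /mu; clear -ltT; lia.
have cb i : ball_size xs n0 i <= #|ball X i| by apply: card_ball.
have -> : (s * s = \sum_z rep S z)%N by rewrite sum_rep cS.
have le1 : (mu * (\sum_(i < c) ball_size xs n0 i) + (s - mu * c) * ball_size xs n0 c <=
   mu * (\sum_(i < c) #|ball X i|) + (s - mu * c) * #|ball X c|)%N.
  by rewrite leq_add // leq_mul // leq_sum.
apply: leq_trans le1 _.
have cardE (A : {set gT}) : (#|A| = \sum_z (z \in A))%N.
  by rewrite -sum1_card big_mkcond; apply: eq_bigr => z _; case: (z \in A).
have -> : (\sum_(i < c) #|ball X i| = \sum_z \sum_(i < c) (z \in ball X i))%N.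
  by rewrite exchange_big; apply: eq_bigr => i _; rewrite cardE.
(* An element at distance d <= c is counted mu (c - d) + (s - mu c) times, that
   is s - mu d. *)
rewrite (cardE (ball X c)) !big_distrr -big_split /=.
apply: leq_sum => z _; case: (boolP (z \in ball X c)) => [zc|nzc]; last first.
  rewrite big1 ?muln0 // => i _; apply/eqP; rewrite eqb0; apply: contra nzc.
  exact: (subsetP (ball_sub X1 (ltnW (ltn_ord i)))).
case: (ex_minnP (ex_intro (fun i => z \in ball X i) c zc)) => d zd dmin.
have led := dmin c zc; have := rep_ball HX' zd; rewrite cS muln1.
suff -> : (\sum_(i < c) (z \in ball X i) = c - d)%N.
  rewrite mulnBr (mulnC mu c) (mulnC mu d) => H.
  by have := leq_mul led (leqnn mu); clear -H lec; lia.
rewrite -[RHS]sum_leq_ord; apply: eq_bigr => i _; congr nat_of_bool.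
apply/idP/idP => [/dmin //|]; move=> ledi; exact: (subsetP (ball_sub X1 ledi)).
Qed.
End Averaging.

(** * Subset sums in a finite abelian group *)

Section SubsetSums.
Local Open Scope ring_scope.
Variable G : finZmodType.
Implicit Types (A B C S : {set G}) (x y z : G).

(** In the group of integers modulo n, the next three notions are convertible
to subset_sum, Sigma and zero_sum_free. They are stated for every finite
abelian group because the search needs nothing else. *)
Definition gsum C : G := \sum_(b in C) b.
Definition Sig B : {set G} := [set gsum C | C : {set G} in powerset B].
Definition zsf B := [forall (C : {set G} | (C \subset B) && (C != set0)), gsum C != 0].
Definition shift x S : {set G} := [set x + y | y in S].
Definition generating B := (<<B>>%g == [set: G]).

Lemma mem_shift x S y : (y \in shift x S) = (y - x \in S).
Proof.
apply/imsetP/idP => [[z zS ->]|H]; first by rewrite addrC addKr.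
by exists (y - x); rewrite // addrC subrK.
Qed.

Lemma card_shift x S : #|shift x S| = #|S|.
Proof. by apply: card_imset; apply: addrI. Qed.

Lemma translateE x S : translate S x = shift x S.
Proof. by apply/setP=> y; rewrite mem_translate mem_shift. Qed.

Lemma SigP B y : reflect (exists2 C : {set G}, C \subset B & y = gsum C) (y \in Sig B).
Proof.
apply: (iffP imsetP) => [[C]|[C CB ->]]; first by rewrite inE => CB ->; exists C.
by exists C; rewrite ?inE.
Qed.

Lemma gsumU1 x C : x \notin C -> gsum (x |: C) = x + gsum C.
Proof. by move=> xC; rewrite /gsum big_setU1. Qed.

Lemma gsumD1 x C : x \in C -> gsum C = x + gsum (C :\ x).
Proof. by move=> xC; rewrite -gsumU1 ?setD1K // setD11. Qed.

Lemma Sig_mono A B : A \subset B -> Sig A \subset Sig B.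
Proof.
move=> AB; apply/subsetP=> y /SigP[C CA ->].
by apply/SigP; exists C => //; apply: subset_trans AB.
Qed.

Lemma Sig0 : Sig set0 = [set 0].
Proof.
apply/setP=> y; rewrite inE; apply/SigP/eqP => [[C]|->].
  by rewrite subset0 => /eqP-> ->; rewrite /gsum big_set0.
by exists set0; rewrite ?sub0set // /gsum big_set0.
Qed.

Lemma zero_in_Sig B : 0 \in Sig B.
Proof. by rewrite (subsetP (Sig_mono (sub0set B))) // Sig0 set11. Qed.

Lemma SigU1 x B : x \notin B -> Sig (x |: B) = Sig B :|: shift x (Sig B).
Proof.
move=> xB; apply/setP=> y; rewrite inE mem_shift; apply/SigP/orP.
  case=> C CB ->; case: (boolP (x \in C)) => xC.
    right; rewrite (gsumD1 xC) addrC addKr; apply/SigP; exists (C :\ x) => //.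
    by rewrite subDset.
  left; apply/SigP; exists C => //; apply/subsetP=> z zC.
  by have := subsetP CB z zC; rewrite !inE => /predU1P[zx|//]; rewrite -zx zC in xC.
case=> /SigP[C CB E].
  by exists C => //; apply: subset_trans (subsetUr _ _).
exists (x |: C); first exact: setUS.
by rewrite gsumU1 -?E ?(contra (subsetP CB x)) // addrC subrK.
Qed.

Lemma zsfP B : reflect (forall C : {set G}, C \subset B -> C != set0 -> gsum C != 0) (zsf B).
Proof.
apply: (iffP forall_inP) => H C; first by move=> CB C0; apply: H; rewrite CB.
by case/andP; apply: H.
Qed.

Lemma zsf_sub A B : A \subset B -> zsf B -> zsf A.
Proof. by move=> AB /zsfP H; apply/zsfP=> C CA; apply: H; apply: subset_trans AB. Qed.

Lemma zsfU1 x B : x \notin B -> zsf (x |: B) = zsf B && (- x \notin Sig B).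
Proof.
move=> xB; apply/zsfP/andP => [H|[/zsfP H xS] C CB C0].
  split; first by apply: (zsf_sub (subsetUr [set x] B)); apply/zsfP.
  apply/negP=> /SigP[C CB E]; have := H (x |: C) (setUS _ CB).
  rewrite gsumU1 -?E ?subrr ?eqxx; last exact: contra (subsetP CB x) _.
  by case/(_ _)/negP => //; apply/set0Pn; exists x; rewrite setU11.
case: (boolP (x \in C)) => xC.
  apply: contra xS; rewrite (gsumD1 xC) addrC addr_eq0 => /eqP <-.
  by apply/SigP; exists (C :\ x) => //; rewrite subDset.
apply: H => //; apply/subsetP=> z zC.
by have := subsetP CB z zC; rewrite !inE => /predU1P[zx|//]; rewrite -zx zC in xC.
Qed.

Lemma zsfD1 x B : zsf B -> x \in B -> zsf (B :\ x) && (- x \notin Sig (B :\ x)).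
Proof. by move=> zB xB; rewrite -zsfU1 ?setD11 // setD1K. Qed.

Lemma SigD1 x B : x \in B -> Sig B = Sig (B :\ x) :|: shift x (Sig (B :\ x)).
Proof. by move=> xB; rewrite -SigU1 ?setD11 // setD1K. Qed.

(** Otherwise the sums of B minus x are stable under translation by x, and
contain - x because they contain 0. *)
Lemma card_SigD1 x B : zsf B -> x \in B -> (#|Sig (B :\ x)| < #|Sig B|)%N.
Proof.
move=> zB xB; rewrite (SigD1 xB); case/andP: (zsfD1 zB xB) => _.
set S := Sig (B :\ x) => nx; rewrite ltnNge; apply: contra nx => le.
have /eqP E : S == S :|: shift x S by rewrite eqEcard subsetUl.
have sub : shift x S \subset S by rewrite {2}E subsetUr.
have /eqP E2 : shift x S == S by rewrite eqEcard sub card_shift /=.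
by rewrite -sub0r -mem_shift E2 zero_in_Sig.
Qed.

Lemma zsf_neq0 B x : zsf B -> x \in B -> x != 0.
Proof.
move=> /zsfP zB xB; have := zB [set x]; rewrite sub1set xB /gsum big_set1; apply=> //.
by apply/set0Pn; exists x; rewrite set11.
Qed.

Lemma zsf_add_neq0 B x y : zsf B -> x \in B -> y \in B -> x != y -> x + y != 0.
Proof.
move=> /zsfP zB xB yB xy; have := zB [set x; y]; rewrite /gsum big_setU1 ?inE // big_set1.
apply; first by rewrite subUset !sub1set xB.
by apply/set0Pn; exists x; rewrite !inE eqxx.
Qed.

Lemma Sig_gen B : Sig B \subset <<B>>%g.
Proof.
apply/subsetP=> y /SigP[C CB ->]; apply: (big_ind (fun z => z \in <<B>>%g)).
- exact: group1.
- by move=> u v; apply: groupM.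
by move=> z zC; apply: mem_gen; apply: subsetP CB z zC.
Qed.

(** The sums S of B minus x and their translate S + x cannot be disjoint, so x
is a difference of two elements of S. *)
Lemma generatingD1 x B : generating B -> x \in B ->
  (#|Sig B| < 2 * #|Sig (B :\ x)|)%N -> generating (B :\ x).
Proof.
move=> /eqP gB xB; rewrite (SigD1 xB); set S := Sig (B :\ x) => lt.
suff xg : x \in <<B :\ x>>%g.
  rewrite /generating -subTset -gB gen_subG; apply/subsetP=> y yB.
  by have [->//|yx] := eqVneq y x; apply: mem_gen; rewrite !inE yx.
have /set0Pn[y] : S :&: shift x S != set0.
  apply: contraTneq lt => S0; have := cardsUI S (shift x S).
  by rewrite S0 cards0 card_shift addn0 -leqNgt => ->; rewrite mul2n -addnn.
rewrite inE mem_shift => /andP[/(subsetP (Sig_gen _)) yg /(subsetP (Sig_gen _)) yxg].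
have := groupM (groupVr yxg) yg.
by rewrite FinRing.zmodMgE FinRing.zmodVgE opprB subrK.
Qed.

Definition symmetrized B : {set G} := 0 |: (B :|: [set - b | b in B]).

Lemma mem_opp B y : (y \in [set - b | b in B]) = (- y \in B).
Proof.
apply/imsetP/idP => [[z zB ->]|H]; first by rewrite opprK.
by exists (- y); rewrite ?opprK.
Qed.

(** In a zero-sum free set b and - b occur together only when b = - b. *)
Lemma card_symmetrized B : zsf B ->
  ((2 * #|B|).+1 <= #|symmetrized B| + #|[set b in B | (b + b == 0)%R]|)%N.
Proof.
move=> zB; set N := [set - b | b in B].
have cN : #|N| = #|B| by apply: card_imset; apply: oppr_inj.
have sub : B :&: N \subset [set b in B | b + b == 0].
  apply/subsetP=> b; rewrite !inE mem_opp => /andP[bB nbB]; rewrite bB /=.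
  have [/eqP|ne] := eqVneq b (- b); first by rewrite -addr_eq0.
  by have := zsf_add_neq0 zB bB nbB ne; rewrite subrr eqxx.
have n0 : 0 \notin B :|: N.
  rewrite inE mem_opp oppr0 orbb; apply/negP=> B0.
  by have := zsf_neq0 zB B0; rewrite eqxx.
have := subset_leq_card sub; have := cardsUI B N; rewrite cN.
rewrite /symmetrized -/N cardsU1 n0 => e le; clear -e le.
by lia.
Qed.

Lemma generating_symmetrized B : generating B -> <<symmetrized B>>%g = [set: G].
Proof.
move=> /eqP gB; apply/eqP; rewrite -subTset -gB genS //.
by apply/subsetP=> b bB; rewrite !inE bB orbT.
Qed.

(** Olson's argument: S & (S + x), for S the sums of B, contains the sums of B
minus x translated by x. If all these sets had more than T elements, then
[averaging] would apply to S and to the generating set of all x and - x. *)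
Lemma exists_small_deletion B T T' xs n0 :
    zsf B -> generating B -> (#|Sig B| <= T')%N -> B != set0 ->
    (xs <= #|symmetrized B|)%N -> (n0 <= #|G|)%N ->
    all (fun s => averaging_fails s T xs n0) (iota T.+2 (T' - T.+1)) ->
  exists2 x, x \in B & (#|Sig (B :\ x)| <= T)%N.
Proof.
move=> zB gB leT' /set0Pn[b bB] lexs len0 numeric.
apply/exists_inP; apply: contraT; rewrite negb_exists_in => /forall_inP big.
have big0 x : x \in B -> ~~ (#|Sig (B :\ x)| <= T)%N by apply: big.
have {}big x : x \in B -> (T < rep (Sig B) x)%N.
  move=> xB; apply: (@leq_trans #|shift x (Sig (B :\ x))|).
    by rewrite card_shift ltnNge big0.
  apply: subset_leq_card; rewrite translateE (SigD1 xB); apply/subsetP=> y.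
  by rewrite !inE !mem_shift inE => ->; rewrite !orbT.
have ltT : (T.+1 < #|Sig B|)%N.
  by apply: leq_ltn_trans (card_SigD1 zB bB); rewrite ltnNge big0.
have in_range s : (s <= T' -> T.+1 < s -> averaging_fails s T xs n0)%N.
  by move=> le lt; move/allP: numeric; apply; rewrite mem_iota lt; move: lt le; clear; lia.
suff : ~~ averaging_fails #|Sig B| T xs n0 by rewrite (in_range _ leT' ltT).
apply: (averaging (X := symmetrized B) (S := Sig B)) => //.
- by rewrite setU11.
- apply/setP=> y; rewrite inE FinRing.zmodVgE !inE !mem_opp opprK oppr_eq0.
  by rewrite orbCA orbC orbA -!orbA orbCA.
- exact: generating_symmetrized.
move=> y; rewrite !inE mem_opp => /or3P[/eqP->|/big//|/big].
  by rewrite -FinRing.zmod1gE rep1 ltnW.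
by rewrite -FinRing.zmodVgE repV.
Qed.
End SubsetSums.

(** * A search through the additive relations of a small set *)

(** Vec x y z stands for the combination x g1 + y g2 + z g3 of three letters.
Lat p a b q c r stands for the lattice of relations spanned by (p, a, b),
(0, q, c) and (0, 0, r). The records are flat, and tests are written with
if instead of boolean connectives, for speed under call by value. *)
Inductive vec := Vec of Z & Z & Z.
Inductive lattice := Lat of Z & Z & Z & Z & Z & Z.

Definition veq (u v : vec) := let: Vec a b c := u in let: Vec x y z := v in
  if Z.eqb a x then if Z.eqb b y then Z.eqb c z else false else false.

Lemma veqP : Equality.axiom veq.
Proof.
case=> a b c [x y z] /=; case: Z.eqb_spec => [->|ne]; last by constructor; case.
case: Z.eqb_spec => [->|ne]; last by constructor; case.
by case: Z.eqb_spec => [->|ne]; constructor; [|case].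
Qed.
HB.instance Definition _ := hasDecEq.Build vec veqP.

Definition vzero := Vec 0 0 0.
Definition vadd u v := let: Vec a b c := u in let: Vec x y z := v in
  Vec (Z.add a x) (Z.add b y) (Z.add c z).
Definition vsub u v := let: Vec a b c := u in let: Vec x y z := v in
  Vec (Z.sub a x) (Z.sub b y) (Z.sub c z).
Definition vopp u := let: Vec a b c := u in Vec (Z.opp a) (Z.opp b) (Z.opp c).
Definition vscale k u := let: Vec a b c := u in
  Vec (Z.mul k a) (Z.mul k b) (Z.mul k c).
Definition vle (u v : vec) := let: Vec a b c := u in let: Vec x y z := v in
  match Z.compare a x with Lt => true | Gt => false | Eq =>
  match Z.compare b y with Lt => true | Gt => false | Eq => Z.leb c z end end.

(* Z.div, with its two most frequent cases made cheap *)
Definition quo x p := match p with Z0 => Z0 | Zpos xH => x | _ => Z.div x p end.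

(* v - k u *)
Definition vreduce k u v := if k is Z0 then v else
  let: Vec a b c := u in let: Vec x y z := v in
  Vec (Z.sub x (Z.mul k a)) (Z.sub y (Z.mul k b)) (Z.sub z (Z.mul k c)).

(** The normal form of a word modulo the relations. *)
Definition red (L : lattice) (v : vec) : vec :=
  let: Lat p a b q c r := L in
  let v := let: Vec x _ _ := v in vreduce (quo x p) (Vec p a b) v in
  let v := let: Vec _ y _ := v in vreduce (quo y q) (Vec 0 q c) v in
  let: Vec _ _ z := v in vreduce (quo z r) (Vec 0 0 r) v.

(** Euclid's algorithm on the first coordinates of two vectors, which clears
the first coordinate of the second one. The fuel n is a bound on the number of
steps; when it runs out the second relation is dropped, which is sound. *)
Fixpoint euclid1 n p a b x y z :=
  if x is Z0 then (Vec p a b, Vec Z0 y z) else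
  if n is n'.+1 then
    let k := Z.div p x in
    euclid1 n' x y z (Z.sub p (Z.mul k x)) (Z.sub a (Z.mul k y)) (Z.sub b (Z.mul k z))
  else (Vec p a b, vzero).

Fixpoint euclid2 n q c y z :=
  if y is Z0 then (Vec Z0 q c, Vec Z0 Z0 z) else
  if n is n'.+1 then
    let k := Z.div q y in
    euclid2 n' y z (Z.sub q (Z.mul k y)) (Z.sub c (Z.mul k z))
  else (Vec Z0 q c, vzero).

Definition ladd (L : lattice) (v : vec) :=
  let: Lat p a b q c r := L in let: Vec x y z := v in
  let: (Vec p a b, Vec _ y z) := euclid1 20 p a b x y z in
  let: (Vec _ q c, Vec _ _ z) := euclid2 20 q c y z in
  Lat p a b q c (Z.gcd r z).

Definition ldet (L : lattice) :=
  let: Lat p _ _ q _ r := L in Z.abs (Z.mul p (Z.mul q r)).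

(** Saturation at p adds v to the relations when p v is one of them. Such a
p v is, modulo p times the lattice, a combination of the three rows with
coefficients in {0, .., p - 1}; a zero row needs no coefficients. *)
Definition zdvd p x := Z.eqb (Z.modulo x p) Z0.
Definition digits (p : nat) (a : Z) :=
  if a is Z0 then [:: Z0] else [seq Z.of_nat i | i <- iota 0 p].
Definition nonzero (x : Z) := if x is Z0 then Zpos xH else x.

Definition combinations (p : nat) (L : lattice) : seq vec :=
  let: Lat a1 a2 a3 b2 b3 c3 := L in
  [seq vadd u w | u <- [seq vscale i (Vec a1 a2 a3) | i <- digits p a1],
     w <- [seq vadd v w | v <- [seq vscale j (Vec Z0 b2 b3) | j <- digits p b2],
                          w <- [seq vscale k (Vec Z0 Z0 c3) | k <- digits p c3]]].

Fixpoint find_quotient (p : Z) (L : lattice) (l : seq vec) : vec :=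
  if l is Vec x y z :: l' then
    if (if zdvd p x then if zdvd p y then zdvd p z else false else false) then
      let v := red L (Vec (Z.div x p) (Z.div y p) (Z.div z p)) in
      if veq v vzero then find_quotient p L l' else v
    else find_quotient p L l'
  else vzero.

Fixpoint saturate_at n (p : nat) (L : lattice) : lattice :=
  if n is n'.+1 then
    let: Lat a1 _ _ b2 _ c3 := L in
    if zdvd (Z.of_nat p) (Z.mul (nonzero a1) (Z.mul (nonzero b2) (nonzero c3))) then
      let v := find_quotient (Z.of_nat p) L (combinations p L) in
      if veq v vzero then L else saturate_at n' p (ladd L v)
    else L
  else L.
Definition saturate (P : seq nat) L := foldl (fun L p => saturate_at 10 p L) L P.

(* has, but stopping at the first success under call by value *)
Fixpoint vhas (a : vec -> bool) (s : seq vec) :=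
  if s is v :: s' then if a v then true else vhas a s' else false.
Definition vmem v (s : seq vec) := vhas (veq v) s.
Fixpoint vundup (acc s : seq vec) :=
  if s is v :: s' then
    if vmem v acc then vundup acc s' else vundup (v :: acc) s'
  else acc.

Definition extend L U x :=
  filter (fun v => ~~ vmem v U) [seq red L (vadd u x) | u <- U].
(** The normal forms of the subset sums of B. *)
Fixpoint sums L B :=
  if B is b :: B' then let U := sums L B' in extend L U b ++ U else [:: vzero].
(** A relation and its opposite have the same normal representative here, so
that only one of them is tried. *)
Definition normal L v := let u := red L (vopp v) in if vle u v then u else v.

(** The cases d1, or d2 but not d1, and so on: the cases already treated are
passed to the later ones as known to be excluded. *)
Fixpoint branch (test : vec -> seq vec -> bool) (D nz : seq vec) :=
  if D is d :: D' then
    if test d nz then branch test D' (d :: nz) else false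
  else true.

(** The elements x_1, .., x_k are added in turn. T bounds the number of sums
after each step, the first j0 elements generate the group, M bounds the order
of the group from below, and multiplication by each p in P is injective. *)
Section Search.
Variables (k j0 : nat) (T P : seq nat) (M : Z).

(** The letters generate a group of order at most ldet L, if this is not 0. *)
Definition small L :=
  match ldet L with Z0 => false | d => Z.ltb d M end.

(** Adds the relation d. The case is closed if the relations leave too small a
group, if they imply an excluded relation of nz, or if sums of B that were
known to be distinct collapse. *)
Definition refine L (full_rank : bool) d (B : seq vec) sz nz
    (cont : lattice -> seq vec -> seq vec -> bool) :=
  let L := saturate P (ladd L d) in
  if (if full_rank then small L else false) then true else
  if vhas (fun v => veq (red L v) vzero) nz then true else
  let B := [seq red L b | b <- B] in
  let U := sums L B in
  if size U < sz then true else if size U == sz then cont L B U else false.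

(** The state: the relations L, the elements B chosen so far, the list U of
their sums, known to be sz distinct elements, the words pend of the next
elements, and words nz known not to vanish. The answer true means that the
case is impossible; n is fuel.

If the next element x is known, then B and x have the sums U and A, the
translates of U by x. Two of these coincide for one of the differences in D,
unless they are all distinct; the latter is impossible when there are more of
them than the bound T allows, and then a part A' of A just large enough for
this suffices.

If the next element is unknown, take one sum more than the number of sums that
can be new. For one of these sums w, the translate of w by the next element is
an old sum u, so that the next element is u - w. When there are not enough sums
for that, the sums may already fill the subgroup H that the letters generate;
two more elements then give three cosets of H, which may exceed the bound. *)
Fixpoint search n L (B U : seq vec) (sz : nat) (pend nz : seq vec) : bool :=
  if n is n'.+1 then
    let j := size B in
    if pend is x :: pend' then
      let x := red L x in
      if vmem x B then true else if vmem (red L (vopp x)) U then true else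
      let A := extend L U x in
      let t := nth 0 T j.+1 in
      let full := sz + size A <= t in
      let A' := if full then A else take (t.+1 - sz) A in
      let gen := j0 <= j + size pend in
      let D := vundup [::] [seq normal L (red L d) |
         d <- filter (fun d => if gen then ~~ small (ladd L d) else true)
                     [seq vsub a u | a <- A', u <- U]] in
      if branch (fun d nz => refine L gen d B sz nz
           (fun L B U => search n' L B U sz pend nz)) D nz
      then if full then search n' L (x :: B) (A ++ U) (sz + size A) pend' nz else true
      else false
    else if j == k then false else
      let need := (nth 0 T j.+1).+1 - sz in
      if need <= sz then
        if (if j0 <= j.+1 then small L else false) then true else
        let C := vundup [::]
          (filter (fun c => if vmem c B then false else ~~ vmem (red L (vopp c)) U)
             [seq red L (vsub u w) | w <- take need U, u <- U]) in
        branch (fun c nz => search n' L B U sz [:: c] [seq vsub c d | d <- nz]) C [::]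
      else if j.+2 <= k then
        match ldet L with
        | Z0 => false
        | d => if Z.leb d (Z.of_nat sz) then nth 0 T j.+2 < 3 * sz else false
        end
      else false
  else false.
End Search.

(** The letters g1, g2 are the first two elements; their four sums are
distinct. The start pend gives the next elements. *)
Definition search_from k j0 T P M pend :=
  search k j0 T P M 20 (Lat 0 0 0 0 0 0) [:: Vec 0 1 0; Vec 1 0 0]
    [:: Vec 1 1 0; Vec 0 1 0; Vec 1 0 0; vzero] 4 pend [::].

Definition search_triple T P M := search_from 3 3 T P M [:: Vec 1 1 0].
(** Four elements with a coincidence between their sums, up to order: two of
them have a third as their sum, or three have the fourth as their sum, or two
and two have the same sum. *)
Definition search_all k j0 T P M :=
  [&& search_from k j0 T P M [:: Vec 1 1 0; Vec 0 0 1],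
      search_from k j0 T P M [:: Vec 0 0 1; Vec 1 1 1]
    & search_from k j0 T P M [:: Vec 0 0 1; Vec 1 1 (-1)]].

(** * Words and relations in a group *)

Section Evaluation.
Local Open Scope ring_scope.
Variable G : finZmodType.
Variables g1 g2 g3 : G.

Definition zact (g : G) (k : Z) : G := g *~ int_of_Z k.

Lemma zactD g k l : zact g (Z.add k l) = zact g k + zact g l.
Proof. by rewrite /zact -mulrzDr; congr (_ *~ _); apply: (rmorphD int_of_Z). Qed.
Lemma zactN g k : zact g (Z.opp k) = - zact g k.
Proof. by rewrite /zact -mulrNz; congr (_ *~ _); apply: (rmorphN int_of_Z). Qed.
Lemma zactM g k l : zact g (Z.mul k l) = zact (zact g l) k.
Proof. by rewrite /zact -mulrzA mulrC; congr (_ *~ _); apply: (rmorphM int_of_Z). Qed.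

Lemma zactDl g h k : zact (g + h) k = zact g k + zact h k.
Proof. by rewrite /zact mulrzDl. Qed.

Definition ev (v : vec) : G := let: Vec x y z := v in zact g1 x + zact g2 y + zact g3 z.

Lemma ev0 : ev vzero = 0.
Proof. by rewrite /ev /zact /= !mulr0z !addr0. Qed.
Lemma ev_add u v : ev (vadd u v) = ev u + ev v.
Proof.
case: u v => a b c [x y z] /=; rewrite !zactD.
by rewrite [RHS]addrACA; congr (_ + _); rewrite addrACA.
Qed.
Lemma ev_opp u : ev (vopp u) = - ev u.
Proof. by case: u => a b c /=; rewrite !zactN !opprD. Qed.
Lemma vsubE u v : vsub u v = vadd u (vopp v).
Proof. by case: u v => a b c [x y z] /=; congr Vec; lia. Qed.
Lemma ev_sub u v : ev (vsub u v) = ev u - ev v.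
Proof. by rewrite vsubE ev_add ev_opp. Qed.
Lemma ev_scale k u : ev (vscale k u) = zact (ev u) k.
Proof. by case: u => a b c /=; rewrite !zactDl !zactM. Qed.
Lemma vreduceE k u v : vreduce k u v = vsub v (vscale k u).
Proof.
case: u v => a b c [x y z]; case: k => [|k|k]; rewrite /vreduce /=; congr Vec; lia.
Qed.

(** All relations of L hold in the group for the letters g1, g2, g3. *)
Definition vanishes (L : lattice) :=
  let: Lat p a b q c r := L in
  [/\ ev (Vec p a b) = 0, ev (Vec 0 q c) = 0 & ev (Vec 0 0 r) = 0].

Lemma zact0 k : zact 0 k = 0.
Proof. by rewrite /zact mul0rz. Qed.

Lemma ev_reduce k u v : ev u = 0 -> ev (vreduce k u v) = ev v.
Proof. by move=> u0; rewrite vreduceE ev_sub ev_scale u0 zact0 subr0. Qed.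

Lemma ev_red L v : vanishes L -> ev (red L v) = ev v.
Proof.
case: L => p a b q c r [E1 E2 E3]; rewrite /red.
case: v => x y z; set v1 := vreduce _ _ _; have <- : ev v1 = ev (Vec x y z) by apply: ev_reduce.
case: v1 => {}x {}y {}z; set v2 := vreduce _ _ _.
have <- : ev v2 = ev (Vec x y z) by apply: ev_reduce.
by case: v2 => {}x {}y {}z; apply: ev_reduce.
Qed.

Lemma ev_reduce0 k u v : ev u = 0 -> ev v = 0 -> ev (vsub u (vscale k v)) = 0.
Proof. by move=> u0 v0; rewrite ev_sub ev_scale u0 v0 zact0 subr0. Qed.

Arguments ev : simpl never.

Lemma euclid1P n p a b x y z : ev (Vec p a b) = 0 -> ev (Vec x y z) = 0 ->
  let: (u, v) := euclid1 n p a b x y z in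
  let: Vec _ y z := v in ev u = 0 /\ ev (Vec 0 y z) = 0.
Proof.
elim: n p a b x y z => [|n IH] p a b x y z u0 v0 /=.
  by case: x v0 => [|x|x] v0; split=> //; apply: ev0.
case: x v0 => [|x|x] v0; first by []; apply: IH => //;
  exact: (ev_reduce0 (Z.div p _) u0 v0).
Qed.

Lemma ev_reduce02 k q c y z : ev (Vec 0 q c) = 0 -> ev (Vec 0 y z) = 0 ->
  ev (Vec 0 (Z.sub q (Z.mul k y)) (Z.sub c (Z.mul k z))) = 0.
Proof. by move=> u0 v0; have := ev_reduce0 k u0 v0; rewrite /= Z.mul_0_r. Qed.

Lemma euclid2P n q c y z : ev (Vec 0 q c) = 0 -> ev (Vec 0 y z) = 0 ->
  let: (u, v) := euclid2 n q c y z in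
  let: (Vec _ q c, Vec _ _ z) := (u, v) in ev (Vec 0 q c) = 0 /\ ev (Vec 0 0 z) = 0.
Proof.
elim: n q c y z => [|n IH] q c y z u0 v0 /=.
  by case: y v0 => [|y|y] v0; split=> //; apply: ev0.
case: y v0 => [|y|y] v0; first by []; apply: IH => //;
  exact: ev_reduce02.
Qed.

Lemma ladd_vanishes L v : vanishes L -> ev v = 0 -> vanishes (ladd L v).
Proof.
case: L v => p a b q c r [x y z] [E1 E2 E3] v0; rewrite /ladd.
have := euclid1P 20 E1 v0; case: euclid1 => [[{}p {}a {}b] [{}x {}y {}z]] [{}E1 {}v0].
have := euclid2P 20 E2 v0; case: euclid2 => [[? {}q {}c] [? {}y {}z]] [{}E2 {}v0].
split=> //; have [s [t <-]] := Z.gcd_bezout r z _ erefl.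
have -> : Vec 0 0 (Z.add (Z.mul s r) (Z.mul t z)) =
   vadd (vscale s (Vec 0 0 r)) (vscale t (Vec 0 0 z)) by rewrite /=; congr Vec; lia.
by rewrite ev_add !ev_scale E3 v0 !zact0 addr0.
Qed.

Lemma vhasE a s : vhas a s = has a s.
Proof. by elim: s => //= v s ->. Qed.
Lemma vmemE v s : vmem v s = (v \in s).
Proof. by rewrite /vmem vhasE; elim: s => //= u s ->; rewrite inE. Qed.
Lemma mem_vundup acc s v : (v \in vundup acc s) = (v \in acc) || (v \in s).
Proof.
elim: s acc => [|u s IH] acc /=; first by rewrite orbF.
rewrite vmemE inE; case: ifP => uacc; rewrite IH ?inE; last by rewrite orbCA orbA.
by case: eqP => // ->; rewrite uacc.
Qed.
Lemma mem_vundup0 s v : (v \in vundup [::] s) = (v \in s).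
Proof. exact: mem_vundup. Qed.

Lemma combinations_vanish p L w : vanishes L -> w \in combinations p L -> ev w = 0.
Proof.
case: L => a1 a2 a3 b2 b3 c3 [E1 E2 E3] /allpairsP[uv [/mapP[i _ ui] vl ->]].
case/allpairsP: vl => vw [/mapP[j _ vj] /mapP[k _ wk] E].
by rewrite E ui vj wk !ev_add !ev_scale E1 E2 E3 !zact0 !addr0.
Qed.

Lemma find_quotientP p L l : vanishes L -> (0 < p)%N ->
  (forall g : G, g *+ p = 0 -> g = 0) ->
  (forall w, w \in l -> ev w = 0) -> ev (find_quotient (Z.of_nat p) L l) = 0.
Proof.
move=> VL p0 tf; elim: l => [|[x y z] l IH] Hl /=; first exact: ev0.
have {}IH : ev (find_quotient (Z.of_nat p) L l) = 0.
  by apply: IH => w wl; apply: Hl; rewrite inE wl orbT.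
case: ifP => // dv; case: ifP => // _; rewrite ev_red //; apply: tf.
have {dv}[dx dy dz] : [/\ Z.modulo x (Z.of_nat p) = Z0, Z.modulo y (Z.of_nat p) = Z0
    & Z.modulo z (Z.of_nat p) = Z0].
  by move: dv; rewrite /zdvd; do 3!case: Z.eqb_spec => // ?.
rewrite -[RHS](Hl (Vec x y z)) ?mem_head //.
(* p times the quotient is the given word of the lattice *)
have -> g : g *+ p = zact g (Z.of_nat p).
  by rewrite /zact pmulrn; congr (_ *~ _); lia.
rewrite -ev_scale; congr ev => /=.
have dvE t : Z.modulo t (Z.of_nat p) = Z0 -> Z.mul (Z.of_nat p) (Z.div t (Z.of_nat p)) = t.
  by move=> H; have := Z.div_mod t (Z.of_nat p); lia.
by rewrite !dvE.
Qed.

Lemma saturate_at_vanishes n p L : vanishes L -> (0 < p)%N ->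
  (forall g : G, g *+ p = 0 -> g = 0) -> vanishes (saturate_at n p L).
Proof.
move=> VL p0 tf; elim: n L VL => //= n IH L VL; case E: L VL => [a1 a2 a3 b2 b3 c3] VL.
case: ifP => // _; case: ifP => // _; apply: IH; apply: ladd_vanishes => //.
by apply: find_quotientP => // w; apply: combinations_vanish.
Qed.

Lemma saturate_vanishes P L : vanishes L ->
  {in P, forall p, (0 < p)%N /\ forall g : G, g *+ p = 0 -> g = 0} ->
  vanishes (saturate P L).
Proof.
rewrite /saturate; elim: P L => [//|p P IH] L VL HP; apply: (IH (saturate_at 10 p L)).
  by have [p0 tf] := HP p (mem_head _ _); apply: saturate_at_vanishes.
by move=> q qP; apply: HP; rewrite inE qP orbT.
Qed.
End Evaluation.
Arguments ev : simpl never.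

(** * Lists of words as sets of sums *)

Lemma quoE x p : quo x p = Z.div x p.
Proof. by case: p => [|[p|p|]|p] //=; rewrite ?Zdiv_0_r ?Z.div_1_r. Qed.

Lemma red_residues L v : exists x y z,
  let: Lat p _ _ q _ r := L in
  red L v = Vec (Z.sub x (Z.mul p (Z.div x p))) (Z.sub y (Z.mul q (Z.div y q)))
                (Z.sub z (Z.mul r (Z.div z r))).
Proof.
case: L v => p a b q c r [x y z]; rewrite /red.
set k := quo x p; exists x; rewrite vreduceE /=.
set y' := Z.sub y _; set l := quo y' q; exists y'; rewrite vreduceE /=.
set z' := Z.sub (Z.sub z _) _; exists z'; rewrite vreduceE /=.
rewrite /l /k !quoE; congr Vec; lia.
Qed.

(** The sign accounts for the remainder having the sign of the divisor. *)
Lemma residue_nat x p : p <> Z0 -> exists2 i, (i < Z.abs_nat p)%N &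
  Z.sub x (Z.mul p (Z.div x p)) = Z.mul (Z.sgn p) (Z.of_nat i).
Proof.
move=> p0; exists (Z.abs_nat (Z.modulo x p)).
  have [?|?] : (Z.lt 0 p \/ Z.lt p 0) by lia.
    by have := Z.mod_pos_bound x p; lia.
  by have := Z.mod_neg_bound x p; lia.
rewrite -Z.mod_eq //.
have [?|?] : (Z.lt 0 p \/ Z.lt p 0) by lia.
  by have := Z.mod_pos_bound x p; lia.
by have := Z.mod_neg_bound x p; lia.
Qed.

Section Span.
Variable G : finZmodType.
Variables g1 g2 g3 : G.
Notation ev := (ev g1 g2 g3).

(** There are |p q r| normal forms. *)
Lemma span_bound L : vanishes g1 g2 g3 L -> ldet L <> Z0 ->
  exists2 H : {set G}, forall v, ev v \in H & Z.le (Z.of_nat #|H|) (ldet L).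
Proof.
case E: L => [p a b q c r] VL D; rewrite -E in VL.
pose f (t : 'I_(Z.abs_nat p) * 'I_(Z.abs_nat q) * 'I_(Z.abs_nat r)) :=
  ev (Vec (Z.mul (Z.sgn p) (Z.of_nat t.1.1)) (Z.mul (Z.sgn q) (Z.of_nat t.1.2))
          (Z.mul (Z.sgn r) (Z.of_nat t.2))).
exists [set f t | t in setT].
  move=> v; rewrite -(ev_red v VL); have [x [y [z]]] := red_residues L v.
  rewrite E => ->; rewrite /= in D.
  have [|i ip ->] := @residue_nat x p; first by lia.
  have [|j jq ->] := @residue_nat y q; first by lia.
  have [|k kr ->] := @residue_nat z r; first by lia.
  by apply/imsetP; exists (Ordinal ip, Ordinal jq, Ordinal kr).
have := leq_imset_card f setT; rewrite cardsT !card_prod !card_ord /=.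
set m := #|_|; nia.
Qed.
End Span.

Section SearchSoundness.
Local Open Scope ring_scope.
Variable G : finZmodType.
Variables g1 g2 g3 : G.
Notation ev := (ev g1 g2 g3).
Notation vanishes := (vanishes g1 g2 g3).
Notation Sigs s := (Sig [set x in s]).

Lemma Sigs_cons x (s : seq G) : x \notin s -> Sigs (x :: s) = Sigs s :|: shift x (Sigs s).
Proof. by move=> xs; rewrite set_cons SigU1 ?inE. Qed.

Lemma mem_extend L U x w : (w \in extend L U x) =
  (w \notin U) && (w \in [seq red L (vadd u x) | u <- U]).
Proof. by rewrite mem_filter vmemE. Qed.

Lemma extend_sub L U x : vanishes L ->
  subseq (map ev (extend L U x)) [seq y + ev x | y <- map ev U].
Proof.
move=> VL; rewrite -map_comp.
have -> : map ((fun y => y + ev x) \o ev) U = map ev [seq red L (vadd u x) | u <- U].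
  by rewrite -map_comp; apply: eq_map => u /=; rewrite ev_red // ev_add.
by apply: map_subseq; apply: filter_subseq.
Qed.

Lemma extendP L U x : vanishes L ->
  [set y in map ev (extend L U x ++ U)] =
  [set y in map ev U] :|: shift (ev x) [set y in map ev U].
Proof.
move=> VL; apply/setP=> y; rewrite !inE mem_shift inE map_cat mem_cat orbC.
case: (boolP (y \in map ev U)) => //= yU; apply/idP/idP.
  move/(mem_subseq (extend_sub _ _ VL)) => /mapP[z zU ->].
  by rewrite addrK.
case/mapP=> u uU E; apply/mapP; exists (red L (vadd u x)).
  rewrite mem_extend (map_f (fun u => red L (vadd u x)) uU) andbT.
  apply: contra yU => H; apply/mapP.
  by exists (red L (vadd u x)) => //; rewrite ev_red // ev_add -E subrK.
by rewrite ev_red // ev_add -E subrK.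
Qed.

Lemma sumsP L B : vanishes L -> uniq (map ev B) ->
  Sigs (map ev B) = [set y in map ev (sums L B)].
Proof.
move=> VL; elim: B => [|b B IH] /=.
  rewrite (_ : [set x in [::]] = set0) ?Sig0; last by apply/setP=> y; rewrite !inE.
  by move=> _; apply/setP=> y; rewrite !inE ev0.
by case/andP=> bB /IH E; rewrite extendP // Sigs_cons // E.
Qed.

Lemma card_set_seq (s : seq G) : #|[set y in s]| = size s -> uniq s.
Proof. by rewrite cardsE => /card_uniqP. Qed.

(** If some case of D holds, the first one that does holds together with the
negation of all previous ones. *)
Lemma branchP (q : pred vec) test D nz : branch test D nz ->
  {in nz, forall v, ~~ q v} -> has q D ->
  exists d nz', [/\ q d, {in nz', forall v, ~~ q v} & test d nz'].
Proof.
elim: D nz => //= d D IH nz; case: ifP => // td br Hnz.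
case: (boolP (q d)) => [qd _|nqd hD]; first by exists d, nz.
by apply: IH br _ hD => v; rewrite inE => /predU1P[->|/Hnz].
Qed.
End SearchSoundness.

(** * Soundness of the search *)

Section Chains.
Local Open Scope ring_scope.
Variable G : finZmodType.
Notation Sigs s := (Sig [set x in s]).

(** The elements of a zero-sum free sequence, last one first, with the bounds T
on the number of sums of its final segments. *)
Fixpoint chain (T : seq nat) (s : seq G) : Prop :=
  if s is x :: s' then
    [/\ chain T s', x \notin s', - x \notin Sigs s' & (#|Sigs s| <= nth 0%N T (size s))%N]
  else True.

Lemma chain_catrev T r s : chain T (catrev r s) -> chain T s.
Proof. by elim: r s => //= x r IH s /IH []. Qed.
Lemma chain_uniq T s : chain T s -> uniq s.
Proof. by elim: s => //= x s IH [/IH -> ->]. Qed.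
End Chains.

Section SearchSoundness.
Local Open Scope ring_scope.
Variable G : finZmodType.
Variables g1 g2 g3 : G.
Notation ev := (ev g1 g2 g3).
Notation vanishes := (vanishes g1 g2 g3).
Notation Sigs s := (Sig [set x in s]).
Variables (k j0 : nat) (T P : seq nat) (M : Z) (xs : seq G).

Hypothesis torsion_free : {in P, forall p, (0 < p)%N /\ forall g : G, g *+ p = 0 -> g = 0}.
Hypothesis large : Z.le M (Z.of_nat #|G|).
Hypothesis xs_chain : chain T xs.
Hypothesis xs_size : size xs = k.
Hypothesis xs_gen : forall r s, xs = catrev r s -> (j0 <= size s)%N ->
  {in s, forall x, exists v, x = ev v} -> forall g, exists v, g = ev v.

Lemma small_contra L : vanishes L -> (forall g, exists v, g = ev v) -> small M L = false.
Proof.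
move=> VL surj; apply: contraFF (erefl false); rewrite /small => sm.
have D : ldet L <> Z0 by move=> E; rewrite E in sm.
have [H HL le] := span_bound VL D.
have HT : H = setT by apply/setP=> g; rewrite inE; have [v ->] := surj g; apply: HL.
have cH : #|H| = #|G| by rewrite HT cardsT.
rewrite cH in le; move: le sm; case: (ldet L) D => // d _ le /Z.ltb_lt lt;
by case: (Z.lt_irrefl M); apply: Z.le_lt_trans large (Z.le_lt_trans _ _ _ le lt).
Qed.

Lemma card_Sigs_cons (bs s : seq G) b : b \notin bs -> uniq s ->
    {in s, forall y, (y - b \in Sigs bs) && (y \notin Sigs bs)} ->
  (#|Sigs bs| + size s <= #|Sigs (b :: bs)|)%N.
Proof.
move=> bbs us Hs; have <- : #|[set y in s]| = size s by rewrite cardsE; apply/card_uniqP.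
have := cardsUI (Sigs bs) [set y in s]; rewrite (_ : _ :&: _ = set0); last first.
  apply/setP=> y; rewrite !inE; apply/andP=> -[yS /Hs/andP[_]]; by rewrite yS.
rewrite cards0 addn0 => <-; apply: subset_leq_card; rewrite Sigs_cons //; apply: setUS.
by apply/subsetP=> y; rewrite inE mem_shift => /Hs/andP[].
Qed.

(** If the sums of bs fill the group H spanned by the letters, then b, b' and
b + b' lie outside H, so that H, b + H and b + b' + H are disjoint sets of
sums. *)
Lemma coset_contra (bs : seq G) b b' L :
    vanishes L -> ldet L <> Z0 -> Z.le (ldet L) (Z.of_nat #|Sigs bs|) ->
    (forall y, y \in Sigs bs -> exists v, y = ev v) ->
    chain T (b' :: b :: bs) ->
  (3 * #|Sigs bs| <= nth 0 T (size bs).+2)%N.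
Proof.
move=> VL D le span [/= [_ bB nb _] b'B nb' leT].
have [H HL leH] := span_bound VL D.
have HE : Sigs bs = H.
  apply/eqP; rewrite eqEcard; apply/andP; split; last by lia.
  by apply/subsetP=> y /span[v ->].
have H0 : 0 \in H by rewrite -HE zero_in_Sig.
have HB y z : y \in H -> z \in H -> y - z \in H.
  by rewrite -{1 2}HE => /span[u ->] /span[v ->]; rewrite -ev_sub.
have HN y : (- y \in H) = (y \in H).
  by apply/idP/idP => yH; have := HB _ _ H0 yH; rewrite sub0r ?opprK.
rewrite HE in nb; rewrite HN in nb.
have HN2 y z : y \in H -> (z + y \in H) = (z \in H).
  move=> yH; apply/idP/idP => zH; last by rewrite -[y]opprK HB // HN.
  by rewrite -(addrK y z) HB.
have {}nb' : (b' \notin H) && (b + b' \notin H).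
  move: nb'; rewrite Sigs_cons // HE inE mem_shift negb_or HN => /andP[-> /=].
  by rewrite -opprD HN addrC.
case/andP: nb' => b'H bb'H.
apply: leq_trans leT; rewrite Sigs_cons // Sigs_cons // HE.
pose A := shift b H; pose C := shift (b + b') H.
have dis y z : y - z \notin H -> shift y H :&: shift z H = set0.
  move=> ny; apply/eqP; rewrite -subset0; apply/subsetP=> w; rewrite !inE !mem_shift.
  case/andP=> wy wz; case/negP: ny; rewrite -HN opprB.
  by have := HB _ _ wy wz; rewrite opprB addrC addrA subrK addrC.
have d1 : H :&: A = set0.
  by rewrite -[H in LHS](_ : shift 0 H = H) ?dis ?sub0r ?HN //; apply/setP=> y; rewrite mem_shift subr0.
have d2 : H :&: C = set0.
  by rewrite -[H in LHS](_ : shift 0 H = H) ?dis ?sub0r ?HN //; apply/setP=> y; rewrite mem_shift subr0.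
have d3 : A :&: C = set0 by rewrite dis // opprD addNKr HN.
have sub : (H :|: A) :|: C \subset (H :|: A) :|: shift b' (H :|: A).
  apply: setUS; apply/subsetP=> y; rewrite !mem_shift inE mem_shift => yC.
  by apply/orP; right; rewrite -addrA -opprD [b' + b]addrC.
apply: leq_trans (subset_leq_card sub).
have := cardsUI (H :|: A) C; rewrite setIUl d2 d3 setU0 cards0 addn0 => ->.
have := cardsUI H A; rewrite d1 cards0 addn0 => ->.
by rewrite !card_shift mulSn mul2n -addnn addnA.
Qed.

(** The invariant: a chain xs that starts with B and continues with pend and r
cannot exist. Once the known elements include a generating set, every group
element is a word in the letters, which makes the test small meaningful. *)
Lemma search_sound n L B U sz pend nz r :
    search k j0 T P M n L B U sz pend nz -> vanishes L ->
    {in nz, forall v, ev v != 0} ->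
    Sigs (map ev B) = [set y in map ev U] -> #|Sigs (map ev B)| = sz -> size U = sz ->
    xs = catrev (map ev pend ++ r) (map ev B) ->
    ((j0 <= size B + size pend)%N -> forall g, exists v, g = ev v) ->
  False.
Proof.
elim: n L B U sz pend nz r => // n IH L B U sz pend nz r + VL Hnz HSig Hsz HU Hxs surj.
have shape : chain T (catrev (map ev pend ++ r) (map ev B)) by rewrite -Hxs.
have uB : uniq (map ev B) by exact: chain_uniq (chain_catrev shape).
have inU v : v \in U -> ev v \in Sigs (map ev B) by move=> vU; rewrite HSig inE map_f.
have uU : uniq (map ev U) by apply: card_set_seq; rewrite -HSig Hsz size_map HU.
have szk : (size B + size pend + size r = k)%N.
  by rewrite -xs_size Hxs catrevE size_cat size_rev size_cat !size_map; lia.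
have notB x : ev x \notin map ev B -> vmem x B = false.
  by move=> H; apply: contraNF H; rewrite vmemE => /(map_f ev).
have notU x : - ev x \notin Sigs (map ev B) -> vmem (red L (vopp x)) U = false.
  by move=> H; apply: contraNF H; rewrite vmemE => /inU; rewrite ev_red // ev_opp.
case: pend surj Hxs szk shape => [|x pend] surj Hxs szk shape.
  rewrite /=; case: eqP => // jk; case: ifP => [need|_].
    case: r Hxs szk shape => [|b r] Hxs szk shape; first by rewrite !addn0 in szk.
    have [_ bB nbB leb] := @chain_catrev _ _ r (b :: map ev B) shape.
    rewrite /= size_map in leb.
    set W := take _ U.
    (* The translates by b of the sums in W would be too many new sums. *)
    have [w wW wb] : exists2 w, w \in W & ev w + b \in Sigs (map ev B).
      apply/hasP; apply: contraT => /hasPn none.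
      have uW : uniq [seq ev w + b | w <- W].
        rewrite (map_comp (fun y => y + b)) map_inj_uniq; last exact: addIr.
        by rewrite /W map_take take_uniq.
      have := card_Sigs_cons bB uW; rewrite size_map size_take HU Hsz => le.
      suff : (sz + (nth 0 T (size B).+1).+1 - sz <= nth 0 T (size B).+1)%N by rewrite addKn ltnn.
      apply: leq_trans leb; apply: leq_trans (le _).
        by move: need; clear; case: ltnP; lia.
      move=> y /mapP[w wW ->]; rewrite addrK inU ?(mem_take wW) //=.
      exact: none.
    have [u uU' E] : exists2 u, u \in U & ev w + b = ev u.
      by move: wb; rewrite HSig inE => /mapP[u ? ?]; exists u.
    have bE : ev (red L (vsub u w)) = b by rewrite ev_red // ev_sub -E addrC addKr.
    have surj' : (j0 <= size B + 1)%N -> forall g, exists v, g = ev v.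
      move=> le; apply: (xs_gen (r := r) (s := b :: map ev B)) => //.
        by rewrite /= size_map -addn1.
      move=> y; rewrite inE => /predU1P[->|/mapP[v _ ->]]; last by exists v.
      by exists (red L (vsub u w)).
    rewrite (_ : (if _ <= _ then _ else _)%N = false); last first.
      by case: ifP => // le; apply: small_contra => //; apply: surj'; rewrite addn1.
    move=> br; have [] := branchP (q := fun c => ev c == b) br.
    - by [].
    - apply/hasP; exists (red L (vsub u w)); last by rewrite bE.
      rewrite mem_vundup0 mem_filter notB ?bE // notU ?bE // /=.
      by apply/allpairsP; exists (w, u).
    move=> c [nz' [/eqP cb nz'b]] run.
    apply: (IH _ _ _ _ _ _ r run) => //.
      by move=> v /mapP[d dnz ->]; rewrite ev_sub subr_eq0 cb eq_sym; apply: nz'b.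
    by rewrite Hxs /= cb.
  case: ifP => // small_k H.
  have [D {}H] : ldet L <> Z0 /\
      (if Z.leb (ldet L) (Z.of_nat sz) then nth 0 T (size B).+2 < 3 * sz else false)%N.
    by case: (ldet L) H.
  move: H; case: ifP => // /Z.leb_le le lt.
  case: r Hxs szk shape => [|b [|b' r]] Hxs szk shape; rewrite /= in szk; try lia.
  have := coset_contra VL D _ _ (@chain_catrev _ _ r (b' :: b :: map ev B) shape).
  rewrite Hsz size_map leqNgt lt; case/(_ le _)/negP => // y.
  by rewrite HSig inE => /mapP[u _ ->]; exists u.
rewrite /=; set b := ev x; set x' := red L x.
have x'E : ev x' = b by rewrite ev_red.
have [_ bB nbB leb] := @chain_catrev _ _ (map ev pend ++ r) (b :: map ev B) shape.
rewrite notB ?x'E // notU ?x'E //; set A := extend L U x'.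
set t := nth 0%N T _; rewrite /= size_map -/t in leb.
have uA : uniq (map ev A).
  apply: (subseq_uniq (extend_sub _ _ VL)); rewrite map_inj_uniq //; exact: addIr.
have subA y : y \in map ev A -> y - b \in Sigs (map ev B).
  move/(mem_subseq (extend_sub _ _ VL)) => /mapP[z zU ->].
  by rewrite x'E addrK HSig inE.
set full := (_ <= t)%N; set A' := if full then A else _.
have A'A : subseq A' A by rewrite /A'; case: (full) => //; apply: take_subseq.
set gen := (j0 <= _)%N; set D := vundup _ _.
case: ifP => // br.
(* No new sum in A' equals an old one, since the corresponding difference is
   one of the refuted cases. *)
have sep a u : a \in A' -> u \in U -> ev a != ev u.
  move=> aA' uU'; apply/eqP=> E; have d0 : ev (vsub a u) = 0 by rewrite ev_sub E subrr.
  have [] := branchP (q := fun d => ev d == 0) br.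
  - by move=> v /Hnz.
  - apply/hasP; exists (normal L (red L (vsub a u))); last first.
      rewrite /normal; case: ifP; rewrite ?ev_red // ?ev_opp ?ev_red // d0 ?oppr0 eqxx //.
    rewrite mem_vundup0; apply: (map_f (fun d => normal L (red L d))).
    rewrite mem_filter; apply/andP; split; last by apply/allpairsP; exists (a, u).
    case Gn: gen => //; rewrite small_contra //; first exact: ladd_vanishes.
    by apply: surj; exact: Gn.
  move=> d [nz' [/eqP d1 Hnz']]; rewrite /refine; set L1 := saturate _ _.
  have VL1 : vanishes L1 by apply: saturate_vanishes => //; apply: ladd_vanishes.
  rewrite (_ : (if gen then _ else _) = false); last first.
    by case: ifP => // Gn; apply: small_contra => //; apply: surj.
  rewrite vhasE (_ : has _ _ = false); last first.
    apply/hasPn=> v /Hnz'; apply: contra => /eqP E1; apply/eqP.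
    by rewrite -(ev_red v VL1) E1 ev0.
  set B1 := map (red L1) B.
  have EB : map ev B1 = map ev B.
    by rewrite -map_comp; apply: eq_map => v; rewrite /= ev_red.
  have HS1 := sumsP VL1 (B := B1); rewrite EB in HS1.
  have {}HS1 := HS1 uB.
  rewrite (_ : (_ < sz)%N = false); last first.
    apply: contraFF (ltnn sz) => lt; rewrite -{1}Hsz HS1 cardsE (leq_ltn_trans _ lt) //.
    by rewrite (leq_trans (card_size _)) // size_map.
  case: eqP => // sz1 run.
  apply: (IH _ _ _ _ _ _ r run) => //; rewrite ?EB ?size_map //.
have sepA : {in map ev A', forall y, y \notin Sigs (map ev B)}.
  move=> y /mapP[a aA' ->]; rewrite HSig inE; apply/mapP=> -[u uU' E].
  by have := sep a u aA' uU'; rewrite E eqxx.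
have uA' : uniq (map ev A') by apply: subseq_uniq uA; apply: map_subseq.
have low := card_Sigs_cons bB uA'; rewrite size_map Hsz in low.
have {}low : (sz + size A' <= #|Sigs (b :: map ev B)|)%N.
  apply: low => y yA'; rewrite sepA // andbT subA //.
  by apply: mem_subseq yA'; apply: map_subseq.
case: (boolP full) => F; [move=> run | move=> _]; last first.
  have := leq_trans low leb; rewrite /A' (negPf F) size_take.
  by move: F; rewrite /full; clear; case: ltnP; lia.
rewrite /A' F in low sepA.
have E : Sigs (map ev (x' :: B)) = [set y in map ev (A ++ U)].
  by rewrite extendP //= Sigs_cons x'E // HSig.
apply: (IH _ _ _ _ _ _ r run) => //.
- apply/eqP; rewrite eqn_leq; apply/andP; split; last by rewrite /= x'E.
  rewrite E cardsE (leq_trans (card_size _)) // size_map size_cat HU addnC //.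
- by rewrite size_cat HU addnC.
- by rewrite Hxs /= x'E.
by move=> le; apply: surj; move: le; rewrite /= addSnnS.
Qed.
End SearchSoundness.

(** * The first relation in a set with few sums *)

Section Relations.
Local Open Scope ring_scope.
Variable G : finZmodType.
Implicit Types (B P M : {set G}).
Notation Sigs s := (Sig [set x in s]).

Lemma gsum_split P M : gsum P = gsum (P :&: M) + gsum (P :\: M).
Proof. by rewrite /gsum (big_setID M). Qed.

(** Two subsets with the same sum exist by counting; removing their common part
makes them disjoint. If one of them were empty, both would be, as B is zero-sum
free. *)
Lemma relation B : zsf B -> (#|Sig B| < 2 ^ #|B|)%N ->
  exists P M, [/\ P \subset B, M \subset B, [disjoint P & M], (0 < #|P| <= #|M|)%N & gsum P = gsum M].
Proof.
move=> /zsfP zB; rewrite -card_powerset => lt.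
have /dinjectivePn[C CB [D]] : ~~ dinjectiveb (@gsum G) (powerset B).
  by apply: contraTN lt => /dinjectiveP inj; rewrite -leqNgt /Sig card_in_imset.
rewrite inE /= => /andP[DC DB] E; rewrite !inE in CB DB.
have CD : gsum (C :\: D) = gsum (D :\: C).
  by move: E; rewrite (gsum_split C D) (gsum_split D C) setIC => /addrI.
have sub1 : C :\: D \subset B by apply: subset_trans (subsetDl _ _) CB.
have sub2 : D :\: C \subset B by apply: subset_trans (subsetDl _ _) DB.
have dis : [disjoint C :\: D & D :\: C].
  rewrite -setI_eq0; apply/eqP/setP=> x; rewrite !inE.
  by case: (x \in C); case: (x \in D).
have gs0 : gsum set0 = 0 :> G by rewrite /gsum big_set0.
have n0 : (C :\: D != set0) && (D :\: C != set0).
  rewrite -negb_or; apply/negP=> /orP H.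
  have both : C :\: D = set0 /\ D :\: C = set0.
    case: H => /eqP H; split=> //; apply/eqP; apply: contraT => /(zB _ _).
      by move/(_ sub2); rewrite -CD H gs0 eqxx.
    by move/(_ sub1); rewrite CD H gs0 eqxx.
  case/negP: DC; case: both => /eqP + /eqP; rewrite !setD_eq0 => s1 s2.
  by rewrite eqEsubset s1 s2.
case/andP: n0; rewrite -!card_gt0 => p1 p2.
case: (leqP #|C :\: D| #|D :\: C|) => [le|/ltnW le].
  by exists (C :\: D), (D :\: C); rewrite p1 le.
by exists (D :\: C), (C :\: D); rewrite p2 le disjoint_sym.
Qed.

(** One element cannot equal another one, so relations have three terms. *)
Lemma relation3 B : zsf B -> (#|Sig B| < 2 ^ #|B|)%N ->
  exists P M, [/\ P \subset B, M \subset B, [disjoint P & M], (0 < #|P| <= #|M|)%N && (1 < #|M|)%N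
     & gsum P = gsum M].
Proof.
move=> zB lt; have [P [M [PB MB dis sz E]]] := relation zB lt.
exists P, M; split=> //; rewrite sz ltnNge; apply/negP=> M1.
have /cards1P[p Pp] : #|P| == 1%N by lia.
have /cards1P[m Mm] : #|M| == 1%N by lia.
move: dis E; rewrite Pp Mm /gsum !big_set1 => dis pm.
by move: dis; rewrite pm -setI_eq0 setIid => /eqP/setP/(_ m); rewrite !inE eqxx.
Qed.

Lemma set_of_seq3 (a b c : G) : [set x in [:: c; b; a]] = [set c] :|: [set a; b].
Proof. by apply/setP=> x; rewrite !inE; case: (x == a); case: (x == b); case: (x == c). Qed.

Lemma triple_relation B : zsf B -> #|B| = 3%N -> (#|Sig B| < 8)%N ->
  exists a b, uniq [:: a + b; b; a] /\ B = [set x in [:: a + b; b; a]].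
Proof.
move=> zB cB lt; have [|P [M [PB MB dis /andP[sz M1] E]]] := relation3 zB; first by rewrite cB.
have cPM : (#|P| + #|M| = #|P :|: M|)%N by rewrite cardsU disjoint_setI0 // cards0 subn0.
have le : (#|P :|: M| <= 3)%N by rewrite -cB subset_leq_card // subUset PB.
have /cards1P[p Pp] : #|P| == 1%N by lia.
have /cards2P[a [b [ab Mab]]] : #|M| == 2%N by lia.
have pE : p = a + b by move: E; rewrite Pp Mab /gsum big_set1 big_setU1 ?inE // big_set1.
have BE : B = P :|: M.
  by apply/eqP; rewrite eq_sym eqEcard subUset PB MB cB; lia.
have BE' : B = [set x in [:: a + b; b; a]] by rewrite set_of_seq3 BE Pp Mab -pE.
by exists a, b; split=> //; apply: card_set_seq; rewrite -BE' cB.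
Qed.

Definition related4 (a b c d : G) := [\/ c = a + b, d = a + b + c | d = a + b - c].

Lemma quadruple_relation B : zsf B -> #|B| = 4%N -> (#|Sig B| < 16)%N ->
  exists a b c d, [/\ uniq [:: d; c; b; a], B = [set x in [:: d; c; b; a]] & related4 a b c d].
Proof.
move=> zB cB lt; have [|P [M [PB MB dis /andP[sz M1] E]]] := relation3 zB; first by rewrite cB.
have cPM : (#|P :|: M| = #|P| + #|M|)%N by rewrite cardsU disjoint_setI0 // cards0 subn0.
have le : (#|P :|: M| <= 4)%N by rewrite -cB subset_leq_card // subUset PB.
suff [a [b [c [d [BE rel]]]]] : exists a b c d, B = [set x in [:: d; c; b; a]] /\ related4 a b c d.
  by exists a, b, c, d; split=> //; apply: card_set_seq; rewrite -BE cB.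
have whole : (#|P| + #|M| = 4)%N -> B = P :|: M.
  by move=> e; apply/eqP; rewrite eq_sym eqEcard subUset PB MB cB cPM e.
have [P1|P2] : #|P| = 1%N \/ #|P| = 2%N by lia.
  have /cards1P[p Pp] : #|P| == 1%N by rewrite P1.
  have [M2|M3] : #|M| = 2%N \/ #|M| = 3%N by lia.
    have /cards2P[a [b [ab Mab]]] : #|M| == 2%N by rewrite M2.
    have pE : p = a + b by move: E; rewrite Pp Mab /gsum big_set1 big_setU1 ?inE // big_set1.
    have : #|B :\: (P :|: M)| == 1%N.
      by rewrite cardsD (setIidPr _) ?subUset ?PB // cB cPM P1 M2.
    case/cards1P=> d Dd; exists a, b, p, d; split; last by constructor 1.
    rewrite -(setID B (P :|: M)) (setIidPr _) ?subUset ?PB // Dd Pp Mab.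
    by apply/setP=> x; rewrite !inE; case: (x == a); case: (x == b); case: (x == p); case: (x == d).
  have [a aM] : exists a, a \in M by apply/set0Pn; rewrite -card_gt0 M3.
  have := cardsD1 a M; rewrite aM M3 => -[] /esym /eqP /cards2P[b [c [bc Mbc]]].
  exists a, b, c, p; split.
    rewrite whole ?P1 ?M3 // Pp -(setD1K aM) Mbc.
    by apply/setP=> x; rewrite !inE; case: (x == a); case: (x == b); case: (x == c); case: (x == p).
  constructor 2; move: E; rewrite Pp (gsumD1 aM) Mbc /gsum big_set1 => ->.
  by rewrite big_setU1 ?inE // big_set1 addrA.
have /cards2P[c [d [cd Pcd]]] : #|P| == 2%N by rewrite P2.
have M2 : #|M| = 2%N by lia.
have /cards2P[a [b [ab Mab]]] : #|M| == 2%N by rewrite M2.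
exists a, b, c, d; split.
  rewrite whole ?P2 ?M2 // Pcd Mab.
  by apply/setP=> x; rewrite !inE; case: (x == a); case: (x == b); case: (x == c); case: (x == d).
constructor 3; move: E; rewrite Pcd Mab /gsum !big_setU1 ?inE // !big_set1 => <-.
by rewrite addrC addKr.
Qed.
End Relations.

(** * Orderings of a set that the search can follow *)

(** Confronted with b = true, closing tactics may try to compute b, which here
would run the search with an unsuitable reduction strategy; the wrapper hides
the equation. *)
Variant certified (b : bool) : Prop := Certified of b.

Section FromSets.
Local Open Scope ring_scope.
Variable G : finZmodType.
Implicit Types (B : {set G}) (s r : seq G).
Notation Sigs s := (Sig [set x in s]).

(** The elements of r are added to B one at a time, within the bounds T. *)
Fixpoint steps (T : seq nat) r B : Prop :=
  if r is x :: r' then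
    [/\ x \notin B, zsf (x |: B), (#|Sig (x |: B)| <= nth 0 T #|B|.+1)%N & steps T r' (x |: B)]
  else True.

Lemma card_SigU1 x B : x \notin B -> (#|Sig (x |: B)| <= 2 * #|Sig B|)%N.
Proof.
move=> xB; rewrite SigU1 // (leq_trans (leq_card_setU _ _)) //.
by rewrite card_shift mul2n -addnn.
Qed.

Lemma chain_cons T x s : chain T s -> zsf [set y in x :: s] -> uniq (x :: s) ->
  (#|Sigs (x :: s)| <= nth 0 T (size s).+1)%N -> chain T (x :: s).
Proof.
move=> cs zs /andP[xs us] le; split=> //.
by move: zs; rewrite set_cons zsfU1 ?inE // => /andP[].
Qed.

Lemma chain_steps T r s : chain T s -> uniq s -> steps T r [set x in s] -> chain T (catrev r s).
Proof.
elim: r s => //= x r IH s cs us [xs zs le st].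
rewrite inE in xs; apply: IH; [|by rewrite /= xs|by rewrite set_cons].
rewrite -set_cons [#|[set _ in s]|]cardsE (card_uniqP us) in zs le.
by apply: chain_cons => //; rewrite /= xs.
Qed.

Lemma Sigs_small (s : seq G) : uniq s -> (#|Sigs s| <= 2 ^ size s)%N.
Proof.
elim: s => [_|x s IH /= /andP[xs us]].
  by rewrite (_ : [set x in [::]] = set0) ?Sig0 ?cards1 //; apply/setP=> y; rewrite !inE.
by rewrite set_cons (leq_trans (card_SigU1 _)) ?inE // expnS leq_mul // IH.
Qed.

Lemma chain_base T s : uniq s -> zsf [set x in s] ->
  (forall i, (i < size s)%N -> (#|Sigs (drop i s)| <= nth 0 T (size s - i))%N) -> chain T s.
Proof.
elim: s => // x s IH us zs le; apply: chain_cons => //; last exact: (le 0%N).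
apply: IH.
- by case/andP: us.
- by apply: zsf_sub zs; rewrite set_cons subsetUr.
by move=> i lti; have := le i.+1; rewrite /= subSS; apply.
Qed.

Lemma generated_span (g1 g2 g3 : G) B : generating B ->
  {in B, forall x, exists v, x = ev g1 g2 g3 v} -> forall g, exists v, g = ev g1 g2 g3 v.
Proof.
move=> /eqP gB HB g; have : g \in <<B>>%g by rewrite gB inE.
case/gen_prodgP=> n [c Hc ->]; elim/big_rec: _ => [|i y _ [v ->]].
  by exists vzero; rewrite ev0.
by have [u ->] := HB _ (Hc i); exists (vadd u v); rewrite ev_add.
Qed.

Lemma evE (g1 g2 g3 : G) : [/\ ev g1 g2 g3 (Vec 1 0 0) = g1, ev g1 g2 g3 (Vec 0 1 0) = g2,
  ev g1 g2 g3 (Vec 0 0 1) = g3 & [/\ ev g1 g2 g3 (Vec 1 1 0) = g1 + g2,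
  ev g1 g2 g3 (Vec 1 1 1) = g1 + g2 + g3 & ev g1 g2 g3 (Vec 1 1 (-1)) = g1 + g2 - g3]].
Proof.
by split; [| | |split]; rewrite /ev /zact /= ?mulr0z ?mulr1z ?mulrN1z ?addr0 ?add0r.
Qed.

(** Here s0 is a generating beginning of the sequence xs, of length at most
j0. *)
Lemma search_from_sound (g1 g2 g3 : G) k j0 T P M r s0 pend :
    let xs := catrev (map (ev g1 g2 g3) pend ++ r) [:: g2; g1] in
    {in P, forall p, (0 < p)%N /\ forall g : G, g *+ p = 0 -> g = 0} ->
    Z.le M (Z.of_nat #|G|) -> chain T xs -> size xs = k ->
    (exists r0, xs = catrev r0 s0) -> (size s0 <= j0)%N -> generating [set x in s0] ->
  certified (search_from k j0 T P M pend) -> False.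
Proof.
move=> xs HP HM ch sz [r0 xsE] lej gs0 runs.
have [e1 e2 e3 [e4 e5 e6]] := evE g1 g2 g3.
have c2 : chain T [:: g2; g1] := chain_catrev ch.
case: c2 => [[_ _ n1 _] n21 n2 _].
have e0 : [set x in [::]] = set0 :> {set G} by apply/setP=> y; rewrite !inE.
have g10 : g1 != 0 by move: n1; rewrite e0 Sig0 inE oppr_eq0.
have S1 : Sigs [:: g1] = [set g1; 0].
  rewrite Sigs_cons // e0 Sig0; apply/setP=> y; rewrite !inE mem_shift inE subr_eq0.
  by rewrite orbC.
move: n2; rewrite S1 !inE negb_or oppr_eq0 => /andP[n21' g20].
have S2 : Sigs [:: g2; g1] = [set y in [:: g1 + g2; g2; g1; 0]].
  rewrite Sigs_cons // S1; apply/setP=> y; rewrite !inE mem_shift !inE.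
  rewrite subr_eq subr_eq0.
  by case: (y == g1 + g2); case: (y == g2); case: (y == g1); case: (y == 0).
rewrite inE in n21.
have uS : uniq [:: g1 + g2; g2; g1; 0].
  have h1 : g1 + g2 != g2 by rewrite -subr_eq0 addrK.
  have h2 : g1 + g2 != g1 by rewrite -subr_eq0 addrAC subrr add0r.
  have h3 : g1 + g2 != 0 by rewrite addr_eq0 eq_sym.
  by rewrite /= !inE !negb_or h1 h2 h3 n21 g10 g20.
have gen r' s' : xs = catrev r' s' -> (j0 <= size s')%N ->
    {in s', forall x, exists v, x = ev g1 g2 g3 v} -> forall g, exists v, g = ev g1 g2 g3 v.
  move=> E le H; apply: generated_span gs0 _ => x; rewrite inE => xs0; apply: H.
  move: (E); rewrite xsE !catrevE => /(congr1 (drop (size (rev r')))); rewrite (@drop_size_cat _ _ (rev r') s') //.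
  have le2 : (size (rev r') <= size (rev r0))%N.
    have := congr1 size (etrans (esym (catrevE r0 s0)) (etrans (esym xsE) E)).
    by move: le lej; rewrite !catrevE !size_cat; clear; lia.
  rewrite drop_cat; case: ltnP => [_ <-|_ <-]; first by rewrite mem_cat xs0 orbT.
  by move: le2; rewrite -subn_eq0 => /eqP ->; rewrite drop0.
case: runs; rewrite /search_from => run.
apply: (search_sound HP HM ch sz gen run (r := r)); clear run => //=.
- by split; exact: ev0.
- by rewrite e1 e2 S2 e4 ev0.
- by rewrite e1 e2 S2 cardsE (card_uniqP uS).
- by rewrite e1 e2.
move=> le; apply: (gen r (catrev (map (ev g1 g2 g3) pend) [:: g2; g1])).
- by rewrite /xs !catrevE rev_cat catA.
- by rewrite catrevE size_cat size_rev size_map addnC.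
move=> x; rewrite catrevE mem_cat mem_rev !inE => /or3P[/mapP[v _ ->]|/eqP->|/eqP->].
- by exists v.
- by exists (Vec 0 1 0).
by exists (Vec 1 0 0).
Qed.
End FromSets.

(** * Lower bounds from the search *)

Section Bounds.
Local Open Scope ring_scope.
Variable G : finZmodType.
Implicit Types (B : {set G}) (s r : seq G).
Notation Sigs s := (Sig [set x in s]).
Variables (P : seq nat) (M : Z).
Hypothesis torsion_free : {in P, forall p, (0 < p)%N /\ forall g : G, g *+ p = 0 -> g = 0}.
Hypothesis large : Z.le M (Z.of_nat #|G|).

Lemma triple_bound T3 B : (T3 < 8)%N -> certified (search_triple [:: 0; 2; 4; T3]%N P M) ->
  zsf B -> #|B| = 3%N -> generating B -> (T3 < #|Sig B|)%N.
Proof.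
move=> T8 []; rewrite /search_triple => /Certified run zB cB gB; rewrite ltnNge; apply/negP=> le.
have [|a [b [us BE]]] := triple_relation zB cB; first exact: leq_ltn_trans T8.
have [_ _ _ [e4 _ _]] := evE a b 0.
have ch : chain [:: 0; 2; 4; T3]%N [:: a + b; b; a].
  apply: chain_base => //; first by rewrite -BE.
  case=> [|i] lti; first by rewrite drop0 -BE.
  have ui : uniq (drop i.+1 [:: a + b; b; a]) by apply: drop_uniq.
  apply: leq_trans (Sigs_small ui) _; rewrite size_drop.
  by case: i lti {ui} => [|[|i]].
apply: (@search_from_sound G a b 0 3 3 _ P M [::] [:: a + b; b; a] [:: Vec 1 1 0] _ _ _ _ _ _ _ run) => //.
- by rewrite /= e4.
- by exists [::]; rewrite /= e4.
- by rewrite -BE.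
Qed.

(** The common core of the bounds below: B is a 4-element set with a relation,
and r lists the elements added to it. *)
Lemma quadruple_search k j0 T4 Ts r B : zsf B -> #|B| = 4%N -> (#|Sig B| <= T4)%N -> (T4 < 16)%N ->
    steps [:: 0, 2, 4, 8, T4 & Ts]%N r B -> (size r + 4 = k)%N -> (4 <= j0 <= k)%N ->
    generating (B :|: [set x in take (j0 - 4) r]) ->
  certified (search_all k j0 [:: 0, 2, 4, 8, T4 & Ts]%N P M) -> False.
Proof.
set T := [:: 0, _ & _]%N => zB cB le T16 st kE jk gB.
have [|a [b [c [d [us BE rel]]]]] := quadruple_relation zB cB; first exact: leq_ltn_trans T16.
have ch4 : chain T [:: d; c; b; a].
  apply: chain_base => //; first by rewrite -BE.
  case=> [|i] lti; first by rewrite drop0 -BE.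
  have ui : uniq (drop i.+1 [:: d; c; b; a]) by apply: drop_uniq.
  apply: leq_trans (Sigs_small ui) _; rewrite size_drop.
  by case: i lti {ui} => [|[|[|i]]].
pose xs := catrev r [:: d; c; b; a].
have ch : chain T xs by apply: chain_steps => //; rewrite -BE.
have sx : size xs = k by rewrite /xs catrevE size_cat size_rev.
pose s0 := catrev (take (j0 - 4) r) [:: d; c; b; a].
have xsE : exists r0, xs = catrev r0 s0.
  exists (drop (j0 - 4) r).
  by rewrite /xs /s0 !catrevE catA -rev_cat cat_take_drop.
have ss : (size s0 <= j0)%N.
  have -> : size s0 = (minn (j0 - 4) (size r) + 4)%N.
    by rewrite /s0 catrevE size_cat size_rev size_take_min.
  by move: jk; clear; lia.
have gs : generating [set x in s0].
  move: gB; congr generating; apply/setP=> x.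
  by rewrite BE !inE /s0 catrevE mem_cat mem_rev !inE orbC.
case; rewrite /search_all => /and3P[/Certified r1 /Certified r2 /Certified r3].
have [e1 e2 e3 [e4 e5 e6]] := evE a b c.
have [f1 f2 f3 [f4 f5 f6]] := evE a b d.
case: rel => [cE|dE|dE].
- apply: (@search_from_sound G a b d k j0 T P M r s0 _ _ _ _ _ _ _ _ r1) => //=;
  by rewrite f3 f4 -cE.
- apply: (@search_from_sound G a b c k j0 T P M r s0 _ _ _ _ _ _ _ _ r2) => //=;
  by rewrite e3 e5 -dE.
- apply: (@search_from_sound G a b c k j0 T P M r s0 _ _ _ _ _ _ _ _ r3) => //=;
  by rewrite e3 e6 -dE.
Qed.

Lemma quadruple_bound T4 B : (T4 < 16)%N -> certified (search_all 4 4 [:: 0; 2; 4; 8; T4]%N P M) ->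
  zsf B -> #|B| = 4%N -> generating B -> (T4 < #|Sig B|)%N.
Proof.
move=> T16 run zB cB gB; rewrite ltnNge; apply/negP=> le.
apply: (quadruple_search (r := [::]) zB cB le T16 _ _ _ _ run) => //.
by rewrite (_ : [set x in _] = set0) ?setU0 //.
Qed.

(** The number e is 1 if the group has no involution, and 0 otherwise for
a group with at most one involution. *)
Variables (e n0 : nat).
Hypothesis symm : forall B, zsf B -> (2 * #|B| + e <= #|symmetrized B|)%N.
Hypothesis large0 : (n0 <= #|G|)%N.

Definition averaging_range (j T T' : nat) :=
  all (fun s : nat => averaging_fails s T (2 * j + e)%N n0) (iota T.+2 (T' - T.+1)).

(** [exists_small_deletion] for sets of j + 1 elements. The range of numbers of
sums for which averaging must fail is checked by computation. *)
Lemma deletion j T T' B : zsf B -> generating B -> #|B| = j.+1 -> (#|Sig B| <= T')%N ->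
  averaging_range j.+1 T T' -> exists x, [/\ x \in B, #|B :\ x| = j & (#|Sig (B :\ x)| <= T)%N].
Proof.
move=> zB gB cB le num.
have B0 : B != set0 by rewrite -card_gt0 cB.
have lex : (2 * j.+1 + e <= #|symmetrized B|)%N by rewrite -cB symm.
have [x xB lx] := exists_small_deletion zB gB le B0 lex large0 num.
by exists x; split=> //; have := cardsD1 x B; rewrite xB cB => -[].
Qed.

Lemma quintuple_bound T4 T5 B : (T4 < 16)%N ->
  averaging_range 5 T4 T5 -> certified (search_all 5 5 [:: 0; 2; 4; 8; T4; T5]%N P M) ->
  zsf B -> #|B| = 5%N -> generating B -> (T5 < #|Sig B|)%N.
Proof.
move=> T16 num run zB cB gB; rewrite ltnNge; apply/negP=> le.
have [x [xB cB4 le4]] := deletion zB gB cB le num.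
have /andP[zB4 _] := zsfD1 zB xB.
apply: (quadruple_search (r := [:: x]) zB4 cB4 le4 T16 _ _ _ _ run) => //.
  by rewrite /= setD1K // setD11 cB4.
rewrite (_ : _ :|: _ = B) // -[in RHS](setD1K xB) setUC; congr (_ :|: _).
by apply/setP=> y; rewrite !inE.
Qed.

(** The bound 28 = 2 * 14 on T6 makes the first deletion leave a generating set,
so that averaging can be applied again; five elements then generate. *)
Lemma sextuple_bound T4 T5 T6 B : (T4 < 16)%N -> (T6 < 28)%N ->
  (forall B, zsf B -> #|B| = 5%N -> 14 <= #|Sig B|)%N ->
  averaging_range 5 T4 T5 -> averaging_range 6 T5 T6 ->
  certified (search_all 6 5 [:: 0; 2; 4; 8; T4; T5; T6]%N P M) ->
  zsf B -> #|B| = 6%N -> generating B -> (T6 < #|Sig B|)%N.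
Proof.
move=> T16 T28 low5 num5 num6 run zB cB gB; rewrite ltnNge; apply/negP=> le.
have [y [yB cB5 le5]] := deletion zB gB cB le num6.
have /andP[zB5 _] := zsfD1 zB yB.
have gB5 : generating (B :\ y).
  by apply: generatingD1 => //; have := low5 _ zB5 cB5; move: le T28; clear; lia.
have [x [xB cB4 le4]] := deletion zB5 gB5 cB5 le5 num5.
have /andP[zB4 _] := zsfD1 zB5 xB.
apply: (quadruple_search (r := [:: x; y]) zB4 cB4 le4 T16 _ _ _ _ run) => //.
  by rewrite /= !setD1K // !setD11 cB4 cB5.
rewrite (_ : _ :|: _ = B :\ y) // -[in RHS](setD1K xB) setUC; congr (_ :|: _).
by apply/setP=> z; rewrite !inE.
Qed.

(** As before, 28 = 2 * 14 and 40 = 2 * 20 keep the sets generating down to five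
elements. *)
Lemma septuple_bound T4 T5 T6 T7 B : (T4 < 16)%N -> (T6 < 28)%N -> (T7 < 40)%N ->
  (forall B, zsf B -> #|B| = 5%N -> 14 <= #|Sig B|)%N ->
  (forall B, zsf B -> #|B| = 6%N -> 20 <= #|Sig B|)%N ->
  averaging_range 5 T4 T5 -> averaging_range 6 T5 T6 -> averaging_range 7 T6 T7 ->
  certified (search_all 7 5 [:: 0; 2; 4; 8; T4; T5; T6; T7]%N P M) ->
  zsf B -> #|B| = 7%N -> generating B -> (T7 < #|Sig B|)%N.
Proof.
move=> T16 T28 T40 low5 low6 num5 num6 num7 run zB cB gB; rewrite ltnNge; apply/negP=> le.
have [z [zB' cB6 le6]] := deletion zB gB cB le num7.
have /andP[zB6 _] := zsfD1 zB zB'.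
have gB6 : generating (B :\ z).
  by apply: generatingD1 => //; have := low6 _ zB6 cB6; move: le T40; clear; lia.
have [y [yB cB5 le5]] := deletion zB6 gB6 cB6 le6 num6.
have /andP[zB5 _] := zsfD1 zB6 yB.
have gB5 : generating (B :\ z :\ y).
  by apply: generatingD1 => //; have := low5 _ zB5 cB5; move: le6 T28; clear; lia.
have [x [xB cB4 le4]] := deletion zB5 gB5 cB5 le5 num5.
have /andP[zB4 _] := zsfD1 zB5 xB.
apply: (quadruple_search (r := [:: x; y; z]) zB4 cB4 le4 T16 _ _ _ _ run) => //.
  by rewrite /= !setD1K // !setD11 cB4 cB5 cB6.
rewrite (_ : _ :|: _ = B :\ z :\ y) // -[in RHS](setD1K xB) setUC; congr (_ :|: _).
by apply/setP=> w; rewrite !inE.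
Qed.
End Bounds.

(** * Reduction to a generating set of a cyclic group *)

Section Transport.
Local Open Scope ring_scope.
Variables (G K : finZmodType) (h : {additive G -> K}).
Hypothesis inj_h : injective h.
Implicit Types (B C : {set G}).

Lemma gsum_imset C : gsum (h @: C) = h (gsum C).
Proof. by rewrite /gsum big_imset /= ?raddf_sum // => x y _ _; apply: inj_h. Qed.

Lemma sub_imset B (D : {set K}) : D \subset h @: B -> exists2 C : {set G}, C \subset B & D = h @: C.
Proof.
move=> DB; exists [set x in B | h x \in D].
  by apply/subsetP=> x; rewrite inE => /andP[].
apply/setP=> y; apply/idP/imsetP => [yD|[x]]; last by rewrite !inE => /andP[_ xD] ->.
by have /imsetP[x xB yx] := subsetP DB y yD; exists x; rewrite // !inE xB -yx.
Qed.

Lemma Sig_imset B : Sig (h @: B) = h @: Sig B.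
Proof.
apply/setP=> y; apply/SigP/imsetP => [[D /sub_imset[C CB ->] ->]|[x /SigP[C CB ->] ->]].
  by exists (gsum C); [apply/SigP; exists C|rewrite gsum_imset].
by exists (h @: C); [apply: imsetS|rewrite gsum_imset].
Qed.

Lemma card_Sig_imset B : #|Sig (h @: B)| = #|Sig B|.
Proof. by rewrite Sig_imset card_imset. Qed.

Lemma zsf_imset B : zsf (h @: B) = zsf B.
Proof.
apply/zsfP/zsfP => H C.
  move=> CB C0; have := H (h @: C) (imsetS _ CB); rewrite gsum_imset imset_eq0.
  by rewrite raddf_eq0 //; apply.
case/sub_imset=> D DB ->; rewrite imset_eq0 gsum_imset raddf_eq0 //; exact: H.
Qed.
End Transport.

Section Cyclic.
Local Open Scope ring_scope.
Variable m : nat.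
Notation Zm := 'I_m.+1.
Implicit Types (x y : Zm) (B : {set Zm}).

Lemma torsion_free_coprime p x : coprime p m.+1 -> x *+ p = 0 -> x = 0.
Proof.
move=> cop; rewrite -FinRing.zmodXgE => /eqP; rewrite -FinRing.zmod1gE -order_dvdn => dp.
have dm : (#[x]%g %| m.+1)%N by have := order_dvdG (in_setT x); rewrite cardsT card_ord.
have : (#[x]%g %| gcdn p m.+1)%N by rewrite dvdn_gcd dp.
by rewrite (eqP cop) dvdn1 order_eq1 => /eqP.
Qed.

(** Twice a non-zero residue z vanishes only for z = (m + 1) / 2. *)
Lemma card_involutions B : 0 \notin B -> (#|[set b in B | (b + b == 0)%R]| <= 1)%N.
Proof.
move=> B0; apply/card_le1_eqP => x y.
have half z : z \in [set b in B | (b + b == 0)%R] -> (2 * (z : nat) = m.+1)%N.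
  rewrite inE => /andP[zB /eqP /(congr1 val)] /= E.
  have z0 : (z : nat) != 0%N by apply: contraNneq B0 => z0; rewrite -(_ : z = 0) //; apply: val_inj.
  have /dvdnP[q Eq] : (m.+1 %| (z : nat) + (z : nat))%N by apply/eqP.
  have lt : ((z : nat) < m.+1)%N := ltn_ord z.
  move: Eq lt z0; clear; move: (nat_of_ord z) => v; rewrite addnn -mul2n; case: q => [|[|q]]; try lia.
move=> /half Ex /half Ey; apply: val_inj; apply/eqP.
by rewrite -(@eqn_pmul2l 2) // Ex Ey.
Qed.

End Cyclic.

Section Core.
Local Open Scope ring_scope.

Definition expmap m (G : finZmodType) (g : G) (i : Zmod m) : G := g *+ i.

Lemma expmap_additive m (G : finZmodType) (g : G) : (0 < m)%N -> g *+ m = 0 ->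
  zmod_morphism (@expmap m G g).
Proof.
move=> m0 gm; have gm' : g *+ m.-1.+1 = 0 by rewrite prednK.
have E i : g *+ (i %% m.-1.+1) = g *+ i.
  by rewrite {2}(divn_eq i m.-1.+1) mulrnDr mulnC mulrnA gm' mul0rn add0r.
move=> i j; rewrite /expmap /= E mulrnDr E; congr (_ + _).
rewrite mulrnBr; last exact: ltnW.
by rewrite gm' sub0r.
Qed.

(** The subgroup generated by B is cyclic; its order is m and C is the inverse
image of B under the embedding of Z/m with this image. *)
Lemma cyclic_core n (B : {set Zmod n}) : (0 < n)%N -> zsf B ->
  exists m (C : {set Zmod m}), [/\ (0 < m)%N, (m %| n)%N, zsf C, generating C
    & #|C| = #|B| /\ #|Sig C| = #|Sig B|].
Proof.
move=> n0 zB.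
have /cyclicP[g Hg] : cyclic <<B>>%g.
  by apply: cyclicS (subsetT _) _; apply/cyclicP; exists Zp1; apply: Zp_cycle.
have m0 := order_gt0 g; set m := #[g]%g in m0.
have gm : g *+ m = 0 by rewrite -FinRing.zmodXgE expg_order.
have mn : (m %| n)%N by have := order_dvdG (in_setT g); rewrite cardsT card_ord prednK.
pose h := @expmap m _ g.
pose hA := GRing.isZmodMorphism.Build _ _ h (expmap_additive m0 gm).
pose H : {additive Zmod m -> Zmod n} := HB.pack h hA.
have injH : injective H.
  move=> i j /eqP; rewrite /= /h /expmap -!FinRing.zmodXgE eq_expg_mod_order => /eqP.
  have lt (l : Zmod m) : (val l < #[g]%g)%N by have := ltn_ord l; rewrite [X in (_ < X)%N]prednK.
  by rewrite (modn_small (lt i)) (modn_small (lt j)) => E; apply: val_inj.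
pose C := [set i | H i \in B].
have BE : B = H @: C.
  apply/setP=> y; apply/idP/imsetP => [yB|[i]]; last by rewrite inE => ? ->.
  have : y \in <[g]>%g by rewrite -Hg mem_gen.
  case/cyclePmin=> i im yE; have im' : (i < m.-1.+1)%N by rewrite prednK.
  have yE' : y = H (Ordinal im') by rewrite yE FinRing.zmodXgE.
  by exists (Ordinal im'); rewrite // inE -yE'.
exists m, C; split=> //.
- by rewrite -(zsf_imset injH) -BE.
- rewrite /generating -subTset; apply/subsetP=> i _.
  have gr : group_set (H @: <<C>>%g).
    apply/group_setP; split; first by apply/imsetP; exists 0; rewrite ?group1 // raddf0.
    move=> _ _ /imsetP[x xC ->] /imsetP[y yC ->]; apply/imsetP; exists (x + y).
      exact: groupM.
    by rewrite raddfD.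
  have : <<B>>%g \subset Group gr by rewrite gen_subG BE imsetS //= subset_gen.
  have HiE : H i = (g ^+ i)%g by rewrite FinRing.zmodXgE.
  move/subsetP/(_ (H i)); rewrite Hg {1}HiE mem_cycle => /(_ isT) /imsetP[j jC].
  by move/injH->.
- by rewrite BE card_imset // card_Sig_imset.
Qed.
End Core.

(** * Exhaustive enumeration in a small cyclic group *)

Fixpoint bor (s t : bitseq) : bitseq :=
  match s, t with
  | b :: s', c :: t' => (if b then true else c) :: bor s' t'
  | _, _ => [::]
  end.
Fixpoint weight (s : bitseq) :=
  if s is b :: s' then (if b then (weight s').+1 else weight s') else 0.

(** A set of residues modulo m is a sequence of m bits, and its translate by x
is the rotation by m - x. The enumeration looks for zero-sum free sets with at
most t + 1 sums, the sum 0 included. *)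
Section Enumeration.
Variables (m t : nat).

(** The elements x of c that can be added to a set with sums S when need more
elements are to follow: - x must not be a sum, and each further element will
contribute at least one new sum. *)
Fixpoint candidates (need : nat) (S : bitseq) (c : seq nat) : seq (nat * bitseq) :=
  if c is x :: c' then
    let y := m - x in
    if nth false S y then candidates need S c' else
    let S' := bor S (rot y S) in
    if need + weight S' <= t.+1 then (x, S') :: candidates need S c'
    else candidates need S c'
  else [::].

(** True means that no need elements of c complete the set; elements are taken
in the order of c. The inner loop is a local fixpoint to make the recursion on
need structural. *)
Fixpoint enumerate need S c : bool :=
  if need is need'.+1 then
    (fix loop l := if l is (x, S') :: l' then
       if enumerate need' S' (unzip1 l') then loop l' else false else true)
      (candidates need' S c)
  else false.
End Enumeration.

(** Sets that contain d, a divisor of m, and no element having a smaller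
greatest common divisor with m. *)
Definition enumerate_from m d k t :=
  enumerate m t k.-1 (mkseq (fun i => (i == 0) || (i == d)) m)
    [seq x <- iota 1 m.-1 | (x != d) && (d <= gcdn x m)].

Lemma size_bor s t : size s = size t -> size (bor s t) = size s.
Proof. by elim: s t => [|b s IH] [|c t] //= [/IH ->]. Qed.
Lemma nth_bor s t i : size s = size t -> nth false (bor s t) i = nth false s i || nth false t i.
Proof.
elim: s t i => [|b s IH] [|c t] // i; first by rewrite !nth_nil.
by move=> [st]; case: i => [|i] /=; [case: b|apply: IH].
Qed.

Lemma weightE s : weight s = \sum_(i < size s) nth false s i.
Proof.
elim: s => [|b s IH] /=; first by rewrite big_ord0.
by rewrite big_ord_recl /= IH; case: b.
Qed.

Section Encoding.
Variable m' : nat.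
Notation m := m'.+1.
Implicit Types (A B C D : {set 'I_m}) (x y : 'I_m) (S : bitseq).

Definition encodes S A := size S = m /\ forall i : 'I_m, nth false S i = (i \in A).

Lemma weight_encodes S A : encodes S A -> weight S = #|A|.
Proof.
case=> sz HS; rewrite weightE sz -sum1_card [RHS]big_mkcond /=.
by apply: eq_bigr => i _; rewrite HS; case: (i \in A).
Qed.

Lemma rot_encodes S A x : encodes S A -> encodes (rot (m - x) S) (shift x A).
Proof.
case=> sz HS; split=> [|i]; first by rewrite size_rot.
have ltx := ltn_ord x; have lti := ltn_ord i.
rewrite mem_shift -HS /rot nth_cat size_drop sz (subKn (ltnW ltx)) /= modnDmr.
have [ix|ix] := ltnP i x.
  rewrite nth_drop addnC modn_small //; move: ix ltx; clear; lia.
rewrite nth_take; last by move: ix lti ltx; clear; lia.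
have -> : i + (m - x) = i - x + m by move: ix ltx; clear; lia.
by rewrite modnDr modn_small // (leq_ltn_trans (leq_subr _ _)).
Qed.

Lemma encodes_step S B x : encodes S (Sig B) -> x \notin B ->
  encodes (bor S (rot (m - x) S)) (Sig (x |: B)).
Proof.
move=> enc xB; have [sz HS] := enc; have [szr HR] := rot_encodes x enc.
split=> [|i]; first by rewrite size_bor ?szr.
by rewrite nth_bor ?szr // HS HR SigU1 // inE.
Qed.

Lemma encodes_opp S B x : encodes S (Sig B) -> (0 < val x)%N ->
  nth false S (m - x) = ((- x)%R \in Sig B).
Proof.
by case=> sz HS x0; rewrite -HS /= modn_small // ltn_subrL x0.
Qed.

Lemma candidatesP t need S c :
  {in candidates m t need S c, forall p, p.2 = bor S (rot (m - p.1) S)}.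
Proof.
move=> p; elim: c => //= y c IH; case: ifP => // _; case: ifP => // _.
by rewrite inE => /predU1P[->|].
Qed.

Lemma mem_candidates t need S c (x : nat) : x \in c -> ~~ nth false S (m - x) ->
  need + weight (bor S (rot (m - x) S)) <= t.+1 ->
  x \in unzip1 (candidates m t need S c).
Proof.
move=> + H1 H2; elim: c => //= y c IH; rewrite inE => /predU1P[<-|xc].
  by rewrite (negPf H1) H2 inE eqxx.
by case: ifP => _; rewrite ?IH //; case: ifP => _; rewrite ?IH // inE IH ?orbT.
Qed.

(** Every element of D adds at least one sum, by [card_SigD1]. *)
Lemma card_Sig_setU (A D : {set 'I_m}) : zsf (A :|: D) -> [disjoint A & D] ->
  #|Sig A| + #|D| <= #|Sig (A :|: D)|.
Proof.
have [n] := ubnP #|D|; elim: n D => // n IH D Dn zAD dis.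
have [->|/set0Pn[x xD]] := eqVneq D set0; first by rewrite cards0 addn0 setU0.
have xA : x \notin A by apply: contraL dis => xA; apply/pred0Pn; exists x; rewrite /= xA.
have E : (A :|: D) :\ x = A :|: D :\ x.
  by apply/setP=> y; rewrite !inE; case: eqP => // ->; rewrite (negPf xA).
have xAD : x \in A :|: D by rewrite inE xD orbT.
have := card_SigD1 zAD xAD; rewrite E (cardsD1 x D) xD.
have /andP[] := zsfD1 zAD xAD; rewrite E => zD _.
have dis' : [disjoint A & D :\ x] by apply: disjointWr dis; apply: subsetDl.
have := IH (D :\ x) _ zD dis'; rewrite [#|D|](cardsD1 x) xD in Dn.
by move=> /(_ Dn) le1 le2; apply: leq_trans le2; rewrite add1n addnS ltnS.
Qed.

(** B is the part already chosen and D the part to be found. Since D is a set,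
one may choose first its element that comes first in the candidates; the rest
of D survives among the later candidates. *)
Lemma enumerate_sound t need S c B D : enumerate m t need S c -> encodes S (Sig B) ->
  {in D, forall x, val x \in c} -> 0 \notin map val (enum D) -> [disjoint B & D] -> #|D| = need ->
  zsf (B :|: D) -> t.+1 < #|Sig (B :|: D)|.
Proof.
elim: need S c B D => // need IH S c B D /= run enc Dc D0 dis cD zBD.
rewrite ltnNge; apply/negP=> le.
have Dpos x : x \in D -> 0 < val x.
  by move=> xD; rewrite lt0n; apply: contraNneq D0 => <-; rewrite map_f // mem_enum.
have xB x : x \in D -> x \notin B.
  by move=> xD; apply: contraL dis => xB; apply/pred0Pn; exists x; rewrite /= xB.
have DU x : x \in D -> B :|: D = (x |: B) :|: (D :\ x).
  move=> xD; apply/setP=> y; rewrite !inE; case: eqP => [->|] //=.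
  by rewrite xD orbT.
have disx x : x \in D -> [disjoint x |: B & D :\ x].
  move=> xD; rewrite -setI_eq0; apply/eqP/setP=> y; rewrite !inE.
  case: eqP => //= _; apply: contraFF (erefl false) => /andP[yB yD].
  by have := xB y yD; rewrite yB.
have cDx x : x \in D -> #|D :\ x| = need.
  by move=> xD; have := cardsD1 x D; rewrite xD cD => -[].
have Dl : {in D, forall x, val x \in unzip1 (candidates m t need S c)}.
  move=> x xD; apply: mem_candidates; first exact: Dc.
    rewrite (encodes_opp enc) ?Dpos //.
    have : zsf (x |: B) by apply: zsf_sub zBD; rewrite (DU x xD) subsetUl.
    by rewrite zsfU1 ?xB // => /andP[].
  rewrite (weight_encodes (encodes_step enc (xB x xD))).
  rewrite addnC -(cDx x xD); apply: leq_trans le; rewrite (DU x xD).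
  by apply: card_Sig_setU; rewrite -?(DU x xD) ?disx.
have lP := @candidatesP t need S c.
elim: (candidates m t need S c) run Dl lP => [_ Dl _|[v S'] l IHl].
  by have /set0Pn[x /Dl] : D != set0 by rewrite -card_gt0 cD.
case: ifP => // runx runl Dl lP.
case: (boolP [exists x in D, val x == v]) => [/exists_inP[x xD /eqP xv]|none]; last first.
  apply: IHl => //; last by move=> p pl; apply: lP; rewrite inE pl orbT.
  move=> x xD; have := Dl x xD; rewrite inE => /predU1P[xv|//].
  by case/negP: none; apply/exists_inP; exists x => //; apply/eqP.
have S'E : S' = bor S (rot (m - x) S) by have /= := lP _ (mem_head _ _); rewrite -xv.
suff : t.+1 < #|Sig (B :|: D)| by rewrite ltnNge le.
rewrite (DU x xD); apply: (IH S' (unzip1 l)) => //.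
- by rewrite S'E; apply: encodes_step; rewrite ?xB.
- move=> y; rewrite !inE => /andP[yx yD]; have := Dl y yD; rewrite inE => /predU1P[|//].
  by rewrite -xv => /val_inj yx'; rewrite yx' eqxx in yx.
- by apply: contra D0 => /mapP[y]; rewrite mem_enum !inE => /andP[_ yD] y0; rewrite y0 map_f // mem_enum.
- exact: disx.
- exact: cDx.
- by rewrite -(DU x xD).
Qed.
End Encoding.

(** * Scaling an element to a divisor of the order *)

(** Units modulo m / d lift to units modulo m. With b' = b / d, the lift is
b' + (m / d) q, where q is the part of m prime to b': a prime divisor of m
divides exactly one of the two terms. *)
Lemma coprime_multiplier b m : 0 < b -> 0 < m ->
  exists2 u, coprime u m & u * gcdn b m = b %[mod m].
Proof.
move=> b0 m0; have d0 : 0 < gcdn b m by rewrite gcdn_gt0 b0.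
set d := gcdn b m in d0 *; have [db dm] := (dvdn_gcdl b m, dvdn_gcdr b m).
rewrite -/d in db dm; set b' := b %/ d; set m' := m %/ d.
have bE : b = b' * d by rewrite divnK.
have mE : m = m' * d by rewrite divnK.
have b'0 : 0 < b' by rewrite divn_gt0 // dvdn_leq.
have cop : coprime b' m'.
  by rewrite /coprime -(eqn_pmul2r d0) mul1n muln_gcdl -bE -mE.
pose q := m`_(\pi(b')^'); exists (b' + m' * q); last first.
  by rewrite mulnDl -bE mulnAC -mE addnC mulnC modnMDl.
rewrite /coprime; apply: contraT => ne1.
have /andP[p_pr p_dv] : prime (pdiv (gcdn (b' + m' * q) m)) && (pdiv (gcdn (b' + m' * q) m) %| gcdn (b' + m' * q) m).
  rewrite pdiv_dvd andbT pdiv_prime // ltn_neqAle eq_sym ne1 gcdn_gt0 m0 orbT //.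
move: (pdiv _) p_pr p_dv => p p_pr; rewrite dvdn_gcd => /andP[pu pm].
have [pb|npb] := boolP (p %| b').
  move: pu; rewrite dvdn_addr // Euclid_dvdM // => /orP[pm'|pq].
    have : p %| gcdn b' m' by rewrite dvdn_gcd pb.
    by rewrite (eqP cop) dvdn1 => /eqP p1; rewrite p1 in p_pr.
  have /(pnatP _ (part_gt0 _ _)) /(_ p p_pr pq) := part_pnat (\pi(b')^') m.
  by rewrite !inE mem_primes p_pr b'0 pb.
have pq : p %| m' * q.
  have [pm'|npm'] := boolP (p %| m'); first by rewrite dvdn_mulr.
  rewrite dvdn_mull //; move: pm; rewrite -(partnC (\pi(b')^') m0) Euclid_dvdM // => /orP[//|].
  move/(pnatP _ (part_gt0 _ _) (part_pnat (\pi(b')^')^' m) p p_pr).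
  by rewrite !inE negbK mem_primes (negPf npb) !andbF.
by case/negP: npb; rewrite -(dvdn_addl _ pq).
Qed.

Section Brute.
Local Open Scope ring_scope.
Variable m' : nat.
Notation m := m'.+1.

Lemma mulrn_morphism u : zmod_morphism (fun x : 'I_m => x *+ u).
Proof. by move=> x y; rewrite mulrnBl. Qed.

(** Multiplication by a unit of Z/m preserves everything. Pick b in B with the
least gcd d with m; for a suitable unit u, b is u d, and dividing B by u gives a
set that contains d itself. *)
Theorem brute_force k t (B : {set 'I_m}) :
    all (fun d => if (d %| m)%N then enumerate_from m d k t else true) (iota 1 m') ->
    (0 < k)%N -> zsf B -> #|B| = k -> (t.+1 < #|Sig B|)%N.
Proof.
move=> run k0 zB cB.
have [b1 b1B] : exists b, b \in B by apply/set0Pn; rewrite -card_gt0 cB.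
have pos b : b \in B -> (0 < val b)%N.
  by move=> /(zsf_neq0 zB); rewrite lt0n; apply: contraNneq => b0; apply/eqP/val_inj.
case: (arg_minnP (fun b : 'I_m => gcdn b m) b1B) => b bB bmin.
have b0 := pos b bB; have dlt : (gcdn b m < m)%N.
  by apply: leq_ltn_trans (ltn_ord b); apply: dvdn_leq => //; apply: dvdn_gcdl.
have [u cu ub] := coprime_multiplier b0 (ltn0Sn m').
set d := gcdn b m in dlt ub bmin.
have d0 : (0 < d)%N by rewrite gcdn_gt0 b0.
pose hA := GRing.isZmodMorphism.Build _ _ (fun x : 'I_m => x *+ u) (mulrn_morphism u).
pose h : {additive 'I_m -> 'I_m} := HB.pack (fun x : 'I_m => x *+ u) hA.
have injh : injective h.
  by apply: raddf_inj => x; apply: torsion_free_coprime.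
pose B1 := [set x | h x \in B].
have BE : B = h @: B1.
  have [g gK hK] := injF_bij injh.
  apply/setP=> y; apply/idP/imsetP => [yB|[x]]; last by rewrite inE => ? ->.
  by exists (g y); rewrite ?inE hK.
have hE x : val (h x) = (u * x %% m)%N by rewrite /= Zp_mulrn /= mulnC.
pose D := Ordinal dlt.
have DB1 : D \in B1.
  rewrite inE (_ : h D = b) //; apply: val_inj.
  by rewrite hE [val D]/= ub (modn_small (ltn_ord b)).
have zB1 : zsf B1 by rewrite -(zsf_imset injh) -BE.
have cB1 : #|B1| = k by rewrite -cB BE card_imset.
have D0 : D != 0 by apply: zsf_neq0 zB1 DB1.
rewrite BE card_Sig_imset //.
have B1E : B1 = [set D] :|: B1 :\ D by rewrite setD1K.
have dvd : (d %| m)%N by apply: dvdn_gcdr.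
have {}run : enumerate_from m d k t.
  have din : d \in iota 1 m' by rewrite mem_iota add1n d0 dlt.
  by have := allP run d din; rewrite dvd.
rewrite B1E; apply: (enumerate_sound run) => //.
- split; first by rewrite size_mkseq.
  move=> i; rewrite nth_mkseq // -[[set D]]setU0 SigU1 ?inE // Sig0 !inE mem_shift inE.
  rewrite subr_eq0; congr (_ || _); apply/eqP/eqP => [E|->] //; exact: val_inj.
- move=> x /setD1P[xD xB1]; rewrite mem_filter mem_iota.
  have hx : h x \in B by move: xB1; rewrite inE.
  have x0 : (0 < val x)%N.
    have := zsf_neq0 zB1 xB1; rewrite lt0n; apply: contraNneq => x0.
    by apply/eqP/val_inj.
  have xd : val x != d by apply: contra xD => /eqP E; apply/eqP/val_inj.
  rewrite xd x0 add1n ltn_ord !andbT /=.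
  have := bmin _ hx; rewrite -[X in gcdn X _]/(val (h x)) hE gcdn_modl.
  by rewrite gcdnC Gauss_gcdr 1?coprime_sym // gcdnC.
- apply/negP=> /mapP[x]; rewrite mem_enum => /setD1P[_ xB1] x0.
  have := zsf_neq0 zB1 xB1; rewrite (_ : x = 0) ?eqxx //.
  exact: val_inj.
- by rewrite -setI_eq0; apply/eqP/setP=> x; rewrite !inE; case: eqP.
- by have := cardsD1 D B1; rewrite DB1 cB1; move: k0; case: (k) => // ? _ [].
- by rewrite -B1E.
Qed.
End Brute.

(** * Sets with few sums *)

(** The pair (i, c) stands for the residue i + c q modulo p q. *)
Definition padd p (x y : nat * nat) := (x.1 + y.1, (x.2 + y.2) %% p).
Fixpoint psums p (l : seq (nat * nat)) :=
  if l is x :: l' then let S := psums p l' in undup (S ++ map (padd p x) S)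
  else [:: (0, 0)].
Fixpoint pfree p (l : seq (nat * nat)) :=
  if l is x :: l' then
    [&& pfree p l', x \notin l', x.2 < p & (0, 0) \notin map (padd p x) (psums p l')]
  else true.

Section Realization.
Variables (m' p q : nat).
Notation m := m'.+1.
Hypothesis pq : p * q = m.

Definition point (x : nat * nat) : 'I_m := inZp (x.1 + x.2 * q).

Let p_gt0 : 0 < p. Proof. by move: pq; case: p. Qed.

Lemma point_add x y : point (padd p x y) = (point x + point y)%R.
Proof.
apply: val_inj; rewrite /= modnDm.
have E : (x.2 + y.2) * q = (x.2 + y.2) %/ p * m + (x.2 + y.2) %% p * q.
  by rewrite -pq mulnA -mulnDl -divn_eq.
have -> : x.1 + x.2 * q + (y.1 + y.2 * q) = x.1 + y.1 + (x.2 + y.2) * q by rewrite mulnDl addnACA.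
by rewrite E addnCA modnMDl.
Qed.

Lemma point_inj x y : x.1 < q -> x.2 < p -> y.1 < q -> y.2 < p -> point x = point y -> x = y.
Proof.
have small z : z.1 < q -> z.2 < p -> z.1 + z.2 * q < m.
  by move=> z1 z2; rewrite -pq (leq_trans (_ : _ < q + z.2 * q)) ?ltn_add2r // -mulSn leq_mul2r z2 orbT.
move=> x1 x2 y1 y2 /(congr1 val) /=; rewrite !modn_small ?small // => E.
have q0 : 0 < q by apply: leq_ltn_trans x1.
case: x y x1 x2 y1 y2 E => a c [b d] /= x1 x2 y1 y2 E.
have cd : c = d.
  have := congr1 (fun z => z %/ q) E; rewrite ![_ + _ * q]addnC !divnMDl //.
  by rewrite !divn_small ?addn0.
by move: E; rewrite cd => /addIn ->.
Qed.

Lemma psums_small l s : s \in psums p l -> s.1 <= sumn (unzip1 l) /\ s.2 < p.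
Proof.
elim: l s => [|x l IH] s /=; first by rewrite inE => /eqP ->.
rewrite mem_undup mem_cat => /orP[/IH[s1 s2]|/mapP[u /IH[u1 u2] ->]].
  by split=> //; apply: leq_trans s1 _; apply: leq_addl.
by rewrite /= leq_add2l u1 ltn_pmod.
Qed.

Definition pset l : {set 'I_m} := [set y in map point l].

(** The first coordinates of all sums stay below q, so points are equal modulo
p q only when the pairs are equal. *)
Lemma Sig_pset l : pfree p l -> sumn (unzip1 l) < q ->
  [/\ uniq (map point l), zsf (pset l) & Sig (pset l) = [set y in map point (psums p l)]].
Proof.
elim: l => [|x l IH] /=.
  have -> : pset [::] = set0 by apply/setP=> y; rewrite !inE.
  move=> _ q0; split=> //; first by apply/zsfP=> C; rewrite subset0 => ->.
  rewrite Sig0; apply/setP=> y; rewrite !inE; congr (y == _).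
  by apply: val_inj; rewrite /= mod0n.
case/and4P=> fl xl x2 nz lt.
have lt' : sumn (unzip1 l) < q by apply: leq_ltn_trans lt; apply: leq_addl.
have x1 : x.1 < q by apply: leq_ltn_trans lt; apply: leq_addr.
have [ul zl Sl] := IH fl lt'.
have inl y : y \in l -> y.1 < q /\ y.2 < p.
  move=> yl; split.
    apply: leq_ltn_trans lt'; elim: (l) yl => //= z l' IHl; rewrite inE => /predU1P[->|/IHl H].
      exact: leq_addr.
    by apply: leq_trans H _; apply: leq_addl.
  by elim: (l) fl yl => //= z l' IHl /and4P[fl' _ z2 _]; rewrite inE => /predU1P[->|/(IHl fl')].
have px : point x \notin map point l.
  apply: contra xl => /mapP[y yl E]; have [y1 y2] := inl y yl.
  by rewrite (point_inj x1 x2 y1 y2 E).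
have psE : pset (x :: l) = point x |: pset l by apply/setP=> y; rewrite !inE.
have pxl : point x \notin pset l by rewrite inE.
split; first by rewrite px.
  rewrite psE zsfU1 // zl /= Sl inE; apply: contra nz => /mapP[s sl E].
  apply/mapP; exists s => //; have [s1 s2] := psums_small sl.
  apply: point_inj; rewrite //= ?ltn_pmod //.
  - exact: leq_ltn_trans (leq0n _) x1.
  - by apply: leq_ltn_trans lt; rewrite leq_add2l.
  by rewrite point_add -E subrr; apply: val_inj; rewrite /= mod0n.
rewrite psE SigU1 // Sl; apply/setP=> y; rewrite !inE mem_shift inE.
apply/orP/mapP => [[/mapP[s sl ->]|/mapP[s sl E]]|[s]].
- by exists s; rewrite // mem_undup mem_cat sl.
- exists (padd p x s); first by rewrite mem_undup mem_cat map_f ?orbT.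
  by rewrite point_add -E addrC subrK.
rewrite mem_undup mem_cat => /orP[sl|/mapP[u u_in ->]] ->; [left|right].
  exact: map_f.
by rewrite point_add addrC addKr map_f.
Qed.
End Realization.

Lemma realize n p l : 0 < n -> 0 < p -> p %| n -> pfree p l -> sumn (unzip1 l) * p < n ->
  exists B : {set Zmod n}, [/\ zsf B, #|B| = size l & #|Sig B| <= size (psums p l)].
Proof.
move=> n0 p0 /dvdnP[q nE] fl lt.
have pq : p * q = n.-1.+1 by rewrite prednK // nE mulnC.
have [|ul zl Sl] := Sig_pset pq fl.
  by rewrite -(ltn_pmul2r p0) -nE.
exists (pset n.-1 q l); split=> //.
  by rewrite cardsE (card_uniqP ul) size_map.
by rewrite Sl cardsE (leq_trans (card_size _)) ?size_map.
Qed.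

(** * The minimum of the listed values *)

Section Minimum.
Variable I : eqType.

Lemma big_min_inftyP (r : seq I) (P : pred I) (F : I -> nat) :
  let v := \big[min_infty/None]_(i <- r | P i) Some (F i) in
  (forall t, v = Some t -> exists2 i, (i \in r) && P i & F i = t) /\
  (forall i, i \in r -> P i -> exists2 t, v = Some t & t <= F i).
Proof.
elim: r => [|i r [IH1 IH2]]; first by rewrite big_nil.
rewrite big_cons; case: (boolP (P i)) => Pi; last first.
  split=> [t /IH1[j /andP[jr Pj] <-]|j]; first by exists j; rewrite // inE jr orbT.
  by rewrite inE => /predU1P[->|/IH2 //]; rewrite (negPf Pi).
case E: (\big[_/_]_(_ <- r | _) _) IH1 IH2 => [s|] IH1 IH2; split.
- move=> t [<-]; rewrite /minn; case: ifP => _; first by exists i; rewrite ?mem_head.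
  by have [j /andP[jr Pj] Fj] := IH1 s erefl; exists j; rewrite // inE jr orbT.
- move=> j; rewrite inE => /predU1P[->|jr] Pj; exists (minn (F i) s); rewrite ?geq_minl //.
  have [_ [<-] le] := IH2 j jr Pj; exact: leq_trans (geq_minr _ _) le.
- by move=> t [<-]; exists i; rewrite ?mem_head.
move=> j; rewrite inE => /predU1P[->|jr] Pj; first by exists (F i).
by have [] := IH2 j jr Pj.
Qed.

End Minimum.

Lemma eq_big_min_infty (I J : eqType) (r : seq I) (P : pred I) (F : I -> nat)
    (r' : seq J) (P' : pred J) (F' : J -> nat) :
    (forall i, i \in r -> P i -> exists j, [/\ j \in r', P' j & F' j <= F i]) ->
    (forall j, j \in r' -> P' j -> exists i, [/\ i \in r, P i & F i <= F' j]) ->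
  \big[min_infty/None]_(i <- r | P i) Some (F i) =
  \big[min_infty/None]_(j <- r' | P' j) Some (F' j).
Proof.
move=> H H'; have [a1 a2] := big_min_inftyP r P F; have [b1 b2] := big_min_inftyP r' P' F'.
case E: (LHS) => [s|]; case E': (RHS) => [t|] //; rewrite /= in a1 a2 b1 b2.
- have [i /andP[ir Pi] Fi] := a1 s E; have [j /andP[jr Pj] Fj] := b1 t E'.
  have [j' [j'r Pj' le1]] := H i ir Pi; have [i' [i'r Pi' le2]] := H' j jr Pj.
  have [t' Et le3] := b2 _ j'r Pj'; have [s' Es le4] := a2 _ i'r Pi'.
  have tt' : t' = t by move: Et; rewrite E' => -[].
  have ss' : s' = s by move: Es; rewrite E => -[].
  congr Some; apply/eqP; rewrite eqn_leq -{1}ss' -{1}Fj (leq_trans le4) //=.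
  by rewrite -tt' -Fi (leq_trans le3).
- have [i /andP[ir Pi] _] := a1 s E; have [j [jr Pj _]] := H i ir Pi.
  by have [t] := b2 j jr Pj; rewrite E'.
have [j /andP[jr Pj] _] := b1 t E'; have [i [ir Pi _]] := H' j jr Pj.
by have [s] := a2 i ir Pi; rewrite E.
Qed.

(** Among the listed values for k whose condition holds at n, one is at most
s - 1: this is the lower bound for a set with s sums. *)
Definition attained k n s := has (fun vc => vc.2 && (vc.1 <= s - 1)) (listed k n).

Lemma has_implied (s : nat) (l l' : seq (nat * bool)) :
    all2 (fun a b => (a.1 == b.1) && (a.2 ==> b.2)) l l' ->
  has (fun vc => vc.2 && (vc.1 <= s)) l -> has (fun vc => vc.2 && (vc.1 <= s)) l'.
Proof.
elim: l l' => [|[v c] l IH] [|[v' c'] l'] //= /andP[/andP[/eqP <- cc'] ll'].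
case/orP=> [/andP[/(implyP cc') -> -> //]|/(IH _ ll') ->]; exact: orbT.
Qed.

(** All conditions say that n is large or divisible by something. *)
Lemma attained_dvdn k m n s : m %| n -> 0 < n -> attained k m s -> attained k n s.
Proof.
move=> mn n0; apply: has_implied.
have dv a : (a %| m) ==> (a %| n) by apply/implyP=> am; apply: dvdn_trans mn.
have le a : (a <= m) ==> (a <= n).
  by apply/implyP=> am; apply: leq_trans am (dvdn_leq n0 mn).
have both a b : ((a <= m) && (b %| m)) ==> ((a <= n) && (b %| n)).
  by apply/implyP=> /andP[/(implyP (le a)) -> /(implyP (dv b)) ->].
by case: k => [|[|[|[|[|[|[|[|k]]]]]]]] //=; rewrite ?dv ?le ?both.
Qed.

(** A set with more than threshold + 1 sums satisfies the lower bound, by the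
least valid listed value or, if there is none, because there are at most m
sums. *)
Definition threshold k m :=
  foldr (fun vc t => if vc.2 then minn vc.1.-1 t else t) m.-1 (listed k m).

Lemma threshold_attained k m s : 0 < m -> s <= m -> (threshold k m).+1 < s -> attained k m s.
Proof.
move=> m0 sm; rewrite /threshold /attained; elim: (listed k m) => [|[v c] l IH] /=.
  by rewrite prednK // ltnNge sm.
case: c => //= lt; case: (leqP v (s - 1)) => //= vs; apply: IH.
by move: lt vs; clear; rewrite /minn; case: ifP; lia.
Qed.

Definition exhausted k m :=
  all (fun d => if d %| m then enumerate_from m d k (threshold k m) else true) (iota 1 m.-1).

Lemma exhausted_attained k m (B : {set Zmod m}) : 0 < m -> exhausted k m -> 0 < k ->
  zsf B -> #|B| = k -> attained k m #|Sig B|.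
Proof.
case: m B => // m B _ ex k0 zB cB; apply: threshold_attained => //.
  by have := max_card (Sig B); rewrite card_ord.
exact: brute_force ex k0 zB cB.
Qed.

(** The enumerations, by evaluation in the virtual machine. Their ranges end
where the searches below become conclusive. For seven elements this is 34 for
even m and 44 for odd m. *)
Lemma exhausted3 : certified (all (exhausted 3) (iota 1 6)).
Proof. by constructor; vm_cast_no_check (erefl true). Qed.
Lemma exhausted4 : certified (all (exhausted 4) (iota 1 10)).
Proof. by constructor; vm_cast_no_check (erefl true). Qed.
Lemma exhausted5 : certified (all (exhausted 5) (iota 1 15)).
Proof. by constructor; vm_cast_no_check (erefl true). Qed.
Lemma exhausted6 : certified (all (exhausted 6) (iota 1 28)).
Proof. by constructor; vm_cast_no_check (erefl true). Qed.
Lemma exhausted7 : certified (all (exhausted 7) (iota 1 33)).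
Proof. by constructor; vm_cast_no_check (erefl true). Qed.
Lemma exhausted7_odd : certified (all (exhausted 7) [seq i.*2.+1 | i <- iota 17 5]).
Proof. by constructor; vm_cast_no_check (erefl true). Qed.

(** * The lower bound in cyclic groups *)

(** The searches. The last threshold is the listed value v itself, since more
than v sums are wanted when 0 is counted. The first ones are powers of 2, and
those from four elements on are what averaging provides when more elements
follow. The primes are those known not to divide the order of the group, and
the last argument bounds that order from below. *)
Lemma search3_odd : certified (search_triple [:: 0; 2; 4; 6] [:: 2] 7).
Proof. by constructor; vm_cast_no_check (erefl true). Qed.
Lemma search3_even : certified (search_triple [:: 0; 2; 4; 5] [::] 7).
Proof. by constructor; vm_cast_no_check (erefl true). Qed.
Lemma search4_coprime6 : certified (search_all 4 4 [:: 0; 2; 4; 8; 10] [:: 2; 3] 11).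
Proof. by constructor; vm_cast_no_check (erefl true). Qed.
Lemma search4 : certified (search_all 4 4 [:: 0; 2; 4; 8; 9] [::] 11).
Proof. by constructor; vm_cast_no_check (erefl true). Qed.
Lemma search5_odd : certified (search_all 5 5 [:: 0; 2; 4; 8; 14; 15] [:: 2] 16).
Proof. by constructor; vm_cast_no_check (erefl true). Qed.
Lemma search5_even : certified (search_all 5 5 [:: 0; 2; 4; 8; 12; 13] [::] 16).
Proof. by constructor; vm_cast_no_check (erefl true). Qed.
Lemma search6_odd : certified (search_all 6 5 [:: 0; 2; 4; 8; 15; 17; 21] [:: 2] 29).
Proof. by constructor; vm_cast_no_check (erefl true). Qed.
Lemma search6_even : certified (search_all 6 5 [:: 0; 2; 4; 8; 15; 16; 19] [::] 29).
Proof. by constructor; vm_cast_no_check (erefl true). Qed.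
Lemma search7_coprime30 :
  certified (search_all 7 5 [:: 0; 2; 4; 8; 15; 19; 23; 28] [:: 2; 3; 5] 44).
Proof. by constructor; vm_cast_no_check (erefl true). Qed.
Lemma search7_odd : certified (search_all 7 5 [:: 0; 2; 4; 8; 14; 18; 22; 27] [:: 2] 44).
Proof. by constructor; vm_cast_no_check (erefl true). Qed.
Lemma search7_even : certified (search_all 7 5 [:: 0; 2; 4; 8; 14; 17; 21; 25] [::] 34).
Proof. by constructor; vm_cast_no_check (erefl true). Qed.

(** A relation involves three elements. *)
Lemma pair_bound (G : finZmodType) (B : {set G}) : zsf B -> #|B| = 2 -> 4 <= #|Sig B|.
Proof.
move=> zB cB; rewrite leqNgt; apply/negP=> lt.
have [|P [M [PB MB dis /andP[/andP[P0 _] M1] _]]] := relation3 zB; first by rewrite cB.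
have cPM : #|P :|: M| = #|P| + #|M| by rewrite cardsU disjoint_setI0 // cards0 subn0.
have : #|P :|: M| <= 2 by rewrite -cB subset_leq_card // subUset PB.
by rewrite cPM; move: P0 M1; clear; lia.
Qed.

Section LowerBound.
Variable m : nat.
Hypothesis m_gt0 : 0 < m.
Implicit Types (B : {set Zmod m}).

Let card_Zm : #|Zmod m| = m. Proof. by rewrite card_ord prednK. Qed.

Lemma torsion_free P : all (fun p => (0 < p) && coprime p m) P ->
  {in P, forall p, (0 < p) /\ forall g : Zmod m, (g *+ p = 0)%R -> g = 0%R}.
Proof.
move=> /allP H p /H /andP[p0 cp]; split=> // g.
by apply: torsion_free_coprime; rewrite prednK.
Qed.

Lemma torsion_free2 : odd m ->
  {in [:: 2], forall p, (0 < p) /\ forall g : Zmod m, (g *+ p = 0)%R -> g = 0%R}.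
Proof. by move=> om; apply: torsion_free; rewrite /= coprime2n om. Qed.

Lemma torsion_free0 :
  {in [::], forall p, (0 < p) /\ forall g : Zmod m, (g *+ p = 0)%R -> g = 0%R}.
Proof. exact: torsion_free. Qed.

Lemma large M : M <= m -> Z.le (Z.of_nat M) (Z.of_nat #|Zmod m|).
Proof. by rewrite card_Zm => ?; lia. Qed.

(** There is at most one involution. *)
Lemma symmetrized_even B : zsf B -> 2 * #|B| + 0 <= #|symmetrized B|.
Proof.
move=> zB; rewrite addn0 -ltnS; apply: leq_trans (card_symmetrized zB) _.
by rewrite -[X in _ <= X]addn1 leq_add2l card_involutions //; apply/negP=> /(zsf_neq0 zB); rewrite eqxx.
Qed.

Lemma symmetrized_odd B : odd m -> zsf B -> 2 * #|B| + 1 <= #|symmetrized B|.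
Proof.
move=> om zB; have := card_symmetrized zB.
rewrite (_ : [set b in B | (b + b == 0)%R] = set0) ?cards0 ?addn0 ?addn1 //.
apply/setP=> b; rewrite !inE; apply/andP=> -[bB /eqP b2].
have [_ tf] := torsion_free2 om (mem_head _ _).
have /eqP := tf b b2; apply/negP; exact: zsf_neq0 zB bB.
Qed.

Lemma attained3 B : zsf B -> #|B| = 3 -> generating B -> attained 3 m #|Sig B|.
Proof.
move=> zB cB gB; have [lt|ge] := ltnP m 7.
  case: exhausted3 => /allP/(_ m) ex; apply: exhausted_attained => //.
  by apply: ex; rewrite mem_iota m_gt0.
rewrite /attained /= orbF; case om: (odd m).
  have := triple_bound (T3 := 6) (torsion_free2 om) (large ge) isT search3_odd zB cB gB.
  rewrite ge; move: #|_| => s; lia.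
have := triple_bound (T3 := 5) torsion_free0 (large ge) isT search3_even zB cB gB.
rewrite ge dvdn2 om /= ; move: #|_| => s; lia.
Qed.

Lemma exhausted_range k N B : certified (all (exhausted k) (iota 1 N)) -> m <= N ->
  0 < k -> zsf B -> #|B| = k -> attained k m #|Sig B|.
Proof.
case=> /allP/(_ m) ex le; apply: exhausted_attained => //.
by apply: ex; rewrite mem_iota m_gt0.
Qed.

Lemma attained4 B : zsf B -> #|B| = 4 -> generating B -> attained 4 m #|Sig B|.
Proof.
move=> zB cB gB; have [le|ge] := leqP m 10; first exact: exhausted_range exhausted4 _ _ _ _.
rewrite /attained /= orbF ge; case co: (coprime 6 m).
  have tf : {in [:: 2; 3], forall p, (0 < p) /\ forall g : Zmod m, (g *+ p = 0)%R -> g = 0%R}.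
    by apply: torsion_free; rewrite /= andbT -coprimeMl.
  have := quadruple_bound (T4 := 10) tf (large ge) isT search4_coprime6 zB cB gB.
  by move: #|_| => s; lia.
have := quadruple_bound (T4 := 9) torsion_free0 (large ge) isT search4 zB cB gB.
have : (2 %| m) || (3 %| m) && (12 <= m).
  move: co; rewrite (_ : 6 = 2 * 3) // coprimeMl coprime2n prime_coprime //.
  by rewrite -[odd m]negbK -dvdn2; case: (boolP (2 %| m)) => //= _; lia.
by move: #|_| ge => s; lia.
Qed.

Lemma attained5 B : zsf B -> #|B| = 5 -> generating B -> attained 5 m #|Sig B|.
Proof.
move=> zB cB gB; have [le|ge] := leqP m 15; first exact: exhausted_range exhausted5 _ _ _ _.
rewrite /attained /= orbF ge; case om: (odd m).
  have := quintuple_bound (T4 := 14) (T5 := 15) (torsion_free2 om) (large ge)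
    (fun B => @symmetrized_odd B om) (leq0n _) isT isT search5_odd zB cB gB.
  by move: #|_| => s; lia.
have := quintuple_bound (T4 := 12) (T5 := 13) torsion_free0 (large ge)
  symmetrized_even (leq0n _) isT isT search5_even zB cB gB.
by rewrite dvdn2 om; move: #|_| ge => s; lia.
Qed.

Section SixAndSeven.
Hypothesis lower5 : forall B, zsf B -> #|B| = 5 -> 14 <= #|Sig B|.

Lemma attained6 B : zsf B -> #|B| = 6 -> generating B -> attained 6 m #|Sig B|.
Proof.
move=> zB cB gB; have [le|ge] := leqP m 28; first exact: exhausted_range exhausted6 _ _ _ _.
have large0 : 29 <= #|Zmod m| by rewrite card_Zm.
rewrite /attained /= orbF; case om: (odd m).
  have := sextuple_bound (T4 := 15) (T5 := 17) (T6 := 21) (torsion_free2 om) (large ge)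
    (fun B => @symmetrized_odd B om) large0 isT isT lower5 isT isT search6_odd zB cB gB.
  by move: #|_| ge => s; lia.
have := sextuple_bound (T4 := 15) (T5 := 16) (T6 := 19) torsion_free0 (large ge)
  symmetrized_even large0 isT isT lower5 isT isT search6_even zB cB gB.
by rewrite dvdn2 om; move: #|_| ge => s; lia.
Qed.

Hypothesis lower6 : forall B, zsf B -> #|B| = 6 -> 20 <= #|Sig B|.

Lemma attained7 B : zsf B -> #|B| = 7 -> generating B -> attained 7 m #|Sig B|.
Proof.
move=> zB cB gB; have [le|ge] := leqP m 33; first exact: exhausted_range exhausted7 _ _ _ _.
case om: (odd m); last first.
  have large0 : 34 <= #|Zmod m| by rewrite card_Zm.
  have := septuple_bound (T4 := 14) (T5 := 17) (T6 := 21) (T7 := 25) torsion_free0 (large ge)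
    symmetrized_even large0 isT isT isT lower5 lower6 isT isT isT search7_even zB cB gB.
  by rewrite /attained /= dvdn2 om; move: #|_| ge => s; lia.
have [lt|ge44] := ltnP m 44.
  case: exhausted7_odd => /allP/(_ m) ex; apply: exhausted_attained => //.
  apply: ex; apply/mapP; exists m./2; last by rewrite -[LHS]odd_double_half om.
  by rewrite mem_iota; move: ge lt (odd_double_half m); rewrite om; lia.
have large0 : 44 <= #|Zmod m| by rewrite card_Zm.
rewrite /attained /= orbF; case co: (coprime 30 m).
  have tf : {in [:: 2; 3; 5], forall p, (0 < p) /\ forall g : Zmod m, (g *+ p = 0)%R -> g = 0%R}.
    by apply: torsion_free; rewrite /= andbT -!coprimeMl.
  have := septuple_bound (T4 := 15) (T5 := 19) (T6 := 23) (T7 := 28) tf (large ge44)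
    (fun B => @symmetrized_odd B om) large0 isT isT isT lower5 lower6 isT isT isT search7_coprime30 zB cB gB.
  by move: #|_| ge44 => s; lia.
have := septuple_bound (T4 := 14) (T5 := 18) (T6 := 22) (T7 := 27) (torsion_free2 om) (large ge44)
  (fun B => @symmetrized_odd B om) large0 isT isT isT lower5 lower6 isT isT isT search7_odd zB cB gB.
have : (3 %| m) || (5 %| m).
  move: co; rewrite (_ : 30 = 2 * (3 * 5)) // !coprimeMl coprime2n om !prime_coprime //=.
  by case: (3 %| m); case: (5 %| m).
by move: #|_| ge44 => s; lia.
Qed.
End SixAndSeven.

End LowerBound.

(** The general case follows from that of generating sets. *)
Lemma attained_any k : (forall m (B : {set Zmod m}), 0 < m -> zsf B -> #|B| = k ->
    generating B -> attained k m #|Sig B|) ->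
  forall n (B : {set Zmod n}), 0 < n -> zsf B -> #|B| = k -> attained k n #|Sig B|.
Proof.
move=> H n B n0 zB cB; have [m [C [m0 mn zC gC [cC <-]]]] := cyclic_core n0 zB.
by apply: (attained_dvdn mn n0); apply: H => //; rewrite cC.
Qed.

Theorem lower_bound k n (B : {set Zmod n}) : 2 <= k <= 7 -> 0 < n -> zsf B -> #|B| = k ->
  attained k n #|Sig B|.
Proof.
move=> hk n0 zB.
have H5 := attained_any (fun m (B : {set Zmod m}) (m0 : 0 < m) zB cB => attained5 m0 zB cB).
have lower5 m : 0 < m -> forall B : {set Zmod m}, zsf B -> #|B| = 5 -> 14 <= #|Sig B|.
  by move=> m0 C zC cC; have := H5 m C m0 zC cC; rewrite /attained /=; move: #|_| => s; lia.
have H6 := attained_any (fun m (B : {set Zmod m}) (m0 : 0 < m) zB cB => attained6 m0 (lower5 m m0) zB cB).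
have lower6 m : 0 < m -> forall B : {set Zmod m}, zsf B -> #|B| = 6 -> 20 <= #|Sig B|.
  by move=> m0 C zC cC; have := H6 m C m0 zC cC; rewrite /attained /=; move: #|_| => s; lia.
move: hk; case: k => [|[|[|[|[|[|[|[|k]]]]]]]] // _ cB.
- rewrite /attained /= orbF; have := pair_bound zB cB; have := max_card (Sig B).
  by rewrite card_ord; move: #|_| n0 => s; clear; lia.
- by apply: attained_any n0 zB cB => m C m0; apply: attained3.
- by apply: attained_any n0 zB cB => m C m0; apply: attained4.
- exact: H5.
- exact: H6.
by apply: attained_any n0 zB cB => m C m0; apply: attained7 => //; [apply: lower5|apply: lower6].
Qed.

Definition is_realized k n v := exists B : {set Zmod n},
  [/\ zsf B, #|B| = k & #|Sig B| - 1 <= v].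

Theorem upper_bound k n vc : 0 < n -> vc \in listed k n -> vc.2 -> is_realized k n vc.1.
Proof.
move=> n0.
have real p l v : pfree p l && (size l == k) && (0 < p) && (size (psums p l) - 1 <= v) ->
    p %| n -> sumn (unzip1 l) * p < n -> is_realized k n v.
  case/andP=> /andP[/andP[fl /eqP <-] p0] le pn lt.
  have [B [zB cB leB]] := realize n0 p0 pn fl lt.
  by exists B; split=> //; apply: leq_trans le; apply: leq_sub2r.
(* Each listed value comes with its p and its pairs (i, c). For p = 1 the set is
   1, .., k; when all i are 0, it lies in the subgroup of order p. *)
move: real; case: k => [|[|[|[|[|[|[|[|k]]]]]]]] // real; rewrite !inE.
- by move/eqP=> -> /= c; apply: (real 1 [:: (1, 0); (2, 0)]).
- case/orP=> /eqP-> /= c.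
    by case/andP: c => c d; apply: (real 2 [:: (0, 1); (1, 0); (1, 1)]); last exact: leq_trans c.
  by apply: (real 1 [:: (1, 0); (2, 0); (3, 0)]).
- case/or4P=> /eqP-> /= c.
  + by apply: (real 9 [:: (0, 1); (0, 3); (0, 4); (0, 7)]).
  + case/andP: c => c d.
    by apply: (real 2 [:: (0, 1); (1, 0); (1, 1); (2, 0)]); last exact: leq_trans c.
  + case/andP: c => c d.
    by apply: (real 3 [:: (0, 1); (1, 0); (1, 1); (1, 2)]); last exact: leq_trans c.
  by apply: (real 1 [:: (1, 0); (2, 0); (3, 0); (4, 0)]).
- case/or3P=> /eqP-> /= c.
  + case/andP: c => c d.
    by apply: (real 2 [:: (0, 1); (1, 0); (1, 1); (2, 0); (2, 1)]); last exact: leq_trans c.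
  + by apply: (real 15 [:: (0, 1); (0, 2); (0, 5); (0, 6); (0, 11)]).
  by apply: (real 1 [:: (1, 0); (2, 0); (3, 0); (4, 0); (5, 0)]).
- case/or3P=> /eqP-> /= c.
  + case/andP: c => c d.
    by apply: (real 2 [:: (0, 1); (1, 0); (1, 1); (2, 0); (2, 1); (3, 0)]); last exact: leq_trans c.
  + by apply: (real 21 [:: (0, 1); (0, 2); (0, 3); (0, 10); (0, 12); (0, 13)]).
  by apply: (real 1 [:: (1, 0); (2, 0); (3, 0); (4, 0); (5, 0); (6, 0)]).
case/or4P=> [/eqP-> c|/eqP-> c|/eqP-> c|/or3P[]/eqP-> c]; rewrite /= in c *.
- by apply: (real 25 [:: (0, 1); (0, 5); (0, 6); (0, 10); (0, 11); (0, 16); (0, 21)]).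
- case/andP: c => c d.
  by apply: (real 2 [:: (0, 1); (1, 0); (1, 1); (2, 0); (2, 1); (3, 0); (3, 1)]); last exact: leq_trans c.
- by apply: (real 27 [:: (0, 1); (0, 2); (0, 9); (0, 10); (0, 11); (0, 19); (0, 20)]).
- case/andP: c => c d.
  by apply: (real 3 [:: (0, 1); (1, 0); (1, 1); (1, 2); (2, 0); (2, 1); (2, 2)]); last exact: leq_trans c.
- case/andP: c => c d.
  by apply: (real 5 [:: (0, 1); (0, 2); (1, 0); (1, 1); (1, 2); (1, 3); (1, 4)]); last exact: leq_trans c.
by apply: (real 1 [:: (1, 0); (2, 0); (3, 0); (4, 0); (5, 0); (6, 0); (7, 0)]).
Qed.

Theorem mainTheorem2 (k n : nat) (hk : 2 <= k <= 7) (hn : 1 <= n) :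
  f n k = \big[min_infty/None]_(vc <- listed k n | vc.2) Some vc.1.
Proof.
rewrite /f; apply: eq_big_min_infty => [B _ /andP[zB /eqP cB]|vc vcl c].
  have /hasP[vc vcl /andP[c le]] := lower_bound hk hn (zB : zsf B) cB.
  by exists vc.
have [B [zB cB le]] := upper_bound hn vcl c.
exists B; split; [exact: mem_index_enum| |exact: le].
by rewrite cB eqxx andbT.
Qed.
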